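(* For any fixed $\omega\in\Omega_i'$, the function $u_{\omega(t)}$ is differentiable at $(T-t,\eta(t,\omega))$ whenever $t\in(0,T)$ is not a jump time of $\omega$, and $$\partial_xu_{\omega(t)}(T-t,\eta(t,\omega))=\partial_qL_{\omega(t)}(\eta(t,\omega),-\dot\eta(t,\omega)),$$ $$\partial_tu_{\omega(t)}(T-t,\eta(t,\omega))=-H_{\omega(t)}\big(\eta(t,\omega),D_xu_{\omega(t)}(T-t,\eta(t,\omega))\big)-(B\mathbf{u})_{\omega(t)}(T-t,\eta(t,\omega)).$$ Moreover, if $t\in(0,T)$ is a jump time of $\omega$, the same holds with $\omega(t)$ replaced by $\omega(t^-)$ (the left limit) and $\dot\eta$ replaced by the left derivative $\frac{d^-}{dt}\eta$.
   Context: $N,m\ge 1$ are integers, $\mathbb{R}_+=[0,+\infty)$. The Hamiltonians $H_1,\dots,H_m:\mathbb{R}^N\times\mathbb{R}^N\to\mathbb{R}$ satisfy: each $H_i$ is uniformly continuous on $\mathbb{R}^N\times B_R$ for every $R>0$ ($B_R$ the open ball of radius $R$ centred at $0$); there are superlinear functions $\alpha,\beta:\mathbb{R}_+\to\mathbb{R}$ (i.e. $\alpha(h)/h\to+\infty$, $\beta(h)/h\to+\infty$ as $h\to+\infty$) with $\alpha(|p|)\le H_i(x,p)\le\beta(|p|)$ for all $(x,p)$; $p\mapsto H_i(x,p)$ is strictly convex for every $x$; $H_i\in C^1(\mathbb{R}^N\times\mathbb{R}^N)$. The Lagrangians are $L_i(x,q)=\sup_{p}\{\langle p,q\rangle-H_i(x,p)\}$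 (they are of class $C^1$). $B=(b_{ij})$ is a real $m\times m$ matrix with $b_{ij}\le 0$ for $j\ne i$ and $\sum_{j}b_{ij}=0$ for every $i$; $(B\mathbf{u})_i=\sum_jb_{ij}u_j$. Random frame: $\Omega$ is the space of right-continuous paths $\omega:\mathbb{R}_+\to\{1,\dots,m\}$ with left limits; the jump times of $\omega$ are its discontinuity points. $\mathcal{F}$ is the $\sigma$-algebra generated by the evaluation maps $\omega\mapsto\omega(t)$, $t\ge0$. $\Omega_i=\{\omega:\omega(0)=i\}$. $\mathbb{P}$ is a probability measure on $(\Omega,\mathcal{F})$ under which $(\omega(t))_{t\ge0}$ is a Markov chain with generator matrix $-B$ (transition matrices $e^{-Bt}$), with $\mathbb{P}(\Omega_i)>0$ for each $i$; $\mathbb{P}_i$ is $\mathbb{P}$ conditioned to $\Omega_i$ and $\mathbb{E}_i$ the corresponding expectation. Admissible curve (on $[0,T]$, starting at $x$): a random variable $\eta:\Omega\to C([0,T];\mathbb{R}^N)$, written $\eta(t,\omega)$, with $\eta(0,\omega)=x$ for all $\omega$, such that for every $\varepsilon>0$ there is $\delta>0$ such that $\sum_j(b_j-a_j)<\delta$ implies $\sum_j|\eta(b_j,\omega)-\eta(a_j,\omega)|<\varepsilon$ for any finite family of pairwise disjoint intervals $(a_j,b_j)\subset[0,T]$ and any $\omega\in\Omega$; and such that $\omega_1\equiv\omega_2$ in $[0,t]$ implies $\eta(\cdot,\omega_1)\equiv\eta(\cdot,\omega_2)$ in $[0,t]$, for any $t\in[0,T]$. Setting: $\mathbf{u}^0:\mathbb{R}^N\to\mathbb{R}^m$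 is bounded and Lipschitz continuous, and $\mathbf{u}$ is the unique viscosity solution of $\partial_tu_i+H_i(x,D_xu_i)+(B\mathbf{u}(t,x))_i=0$ in $(0,+\infty)\times\mathbb{R}^N$, $i\in\{1,\dots,m\}$, with $\mathbf{u}(0,\cdot)=\mathbf{u}^0$, that is bounded and uniformly continuous on $[0,T]\times\mathbb{R}^N$ for every $T>0$ (it is then Lipschitz continuous on each $[0,T]\times\mathbb{R}^N$). $T>0$, $x\in\mathbb{R}^N$, $i\in\{1,\dots,m\}$ are fixed, and $\eta:\Omega\to C([0,T];\mathbb{R}^N)$ is an admissible curve starting at $x$ which minimizes the Lax–Oleinik functional, i.e. $$u_i(T,x)=\mathbb{E}_i\Big[u^0_{\omega(T)}(\eta(T,\omega))+\int_0^TL_{\omega(s)}(\eta(s,\omega),-\dot\eta(s,\omega))\,ds\Big],$$ and this equals the infimum of the same functional over all admissible curves starting at $x$. Set $L_{G_j}(t,x,q)=L_j(x,q)-(B\mathbf{u}(t,x))_j$. $\Omega_i'\subset\Omega_i$ is a fixed set of full $\mathbb{P}_i$-measure such that for all $\omega\in\Omega_i'$, whenever $0\le a<b\le T$ and $\omega$ is constantly equal to some $j$ on $[a,b)$, $$u_j(T-a,\eta(a,\omega))-u_j(T-b,\eta(b,\omega))=\int_a^bL_{G_j}(T-s,\eta(s,\omega),-\dot\eta(s,\omega))\,ds$$ (such a set exists). For $\omega\in\Omega_i'$ it is known that $\eta(\cdot,\omega)$ is continuously differentiable in $(0,T)$ outside the jump times of $\omega$ and left- and right-differentiable at the jump times.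 *)

(* Defs.v *)
(* Space and the set of modes are 'rV[R]_N.+1 and 'I_m.+1,
   which makes both dimensions at least 1. *)
From HB Require Import structures.
From mathcomp Require Import all_boot all_order all_algebra.
From mathcomp Require Import all_classical all_reals all_analysis.

Set Implicit Arguments.
Unset Strict Implicit.
Unset Printing Implicit Defensive.
Import Order.TTheory GRing.Theory Num.Theory.
Import numFieldNormedType.Exports.

Local Open Scope classical_set_scope.
Local Open Scope ring_scope.

Definition dot (R : realType) (n : nat) (p q : 'rV[R]_n) : R :=
  \sum_(k < n) p 0 k * q 0 k.

(* The library norm `|v| on 'rV[R]_n is the sup norm; this is the Euclidean one. *)
Definition enorm (R : realType) (n : nat) (v : 'rV[R]_n) : R :=
  Num.sqrt (dot v v).

Definition grad (R : realType) (n : nat) (f : 'rV[R]_n -> R) (x : 'rV[R]_n) :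
    'rV[R]_n :=
  \row_(k < n) 'D_(delta_mx 0 k : 'rV[R]_n) f x.

(* For open A only: derivatives are not relative to A. *)
Definition C1_on (R : realType) (V : normedModType R) (A : set V)
    (f : V -> R) : Prop :=
  forall z, A z ->
    differentiable f z /\ (forall v, {for z, continuous ('D_v f)}).

Definition unif_continuous_on (R : realType) (V W : normedModType R)
    (A : set V) (f : V -> W) : Prop :=
  forall e : R, 0 < e -> exists2 d : R, 0 < d &
    forall z w, A z -> A w -> `|z - w| < d -> `|f z - f w| < e.

Definition left_quotient_limit (R : realType) (V : normedModType R)
    (f : R -> V) (t : R) : set_system V :=
  h^-1 *: (f (h + t) - f t) @[h --> 0^'-].

Definition right_quotient_limit (R : realType) (V : normedModType R)
    (f : R -> V) (t : R) : set_system V :=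
  h^-1 *: (f (h + t) - f t) @[h --> 0^'+].

Definition left_derivative (R : realType) (V : normedModType R)
    (f : R -> V) (t : R) : V :=
  lim (left_quotient_limit f t).

Definition expmx (R : realType) (n : nat) (A : 'M[R]_n.+1) : 'M[R]_n.+1 :=
  limn (series (fun k : nat => (k`!%:R)^-1 *: A ^+ k)).

Definition superlinear (R : realType) (a : R -> R) : Prop :=
  a h / h @[h --> +oo] --> +oo.

Definition strictly_convex (R : realType) (n : nat) (f : 'rV[R]_n -> R) : Prop :=
  forall (p q : 'rV[R]_n) (l : R), p != q -> 0 < l < 1 ->
    f (l *: p + (1 - l) *: q) < l * f p + (1 - l) * f q.

Definition hamiltonians (R : realType) (N m : nat)
    (H : 'I_m.+1 -> 'rV[R]_N.+1 -> 'rV[R]_N.+1 -> R) : Prop :=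
  [/\ forall i r, 0 < r ->
        unif_continuous_on [set z | enorm z.2 < r]
          (fun z : 'rV[R]_N.+1 * 'rV[R]_N.+1 => H i z.1 z.2),
      exists a b : R -> R, [/\ superlinear a, superlinear b &
        forall i x p, a (enorm p) <= H i x p <= b (enorm p)],
      forall i x, strictly_convex (H i x) &
      forall i, C1_on [set: 'rV[R]_N.+1 * 'rV[R]_N.+1]
                  (fun z => H i z.1 z.2)].

Definition lagrangian (R : realType) (N m : nat)
    (H : 'I_m.+1 -> 'rV[R]_N.+1 -> 'rV[R]_N.+1 -> R)
    (i : 'I_m.+1) (x q : 'rV[R]_N.+1) : R :=
  sup [set dot p q - H i x p | p in [set: 'rV[R]_N.+1]].

Definition coupling_matrix (R : realType) (m : nat) (B : 'M[R]_m.+1) : Prop :=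
  (forall i j, j != i -> B i j <= 0) /\ (forall i, \sum_j B i j = 0).

Definition lagrangianG (R : realType) (N m : nat)
    (H : 'I_m.+1 -> 'rV[R]_N.+1 -> 'rV[R]_N.+1 -> R) (B : 'M[R]_m.+1)
    (u : R -> 'rV[R]_N.+1 -> 'cV[R]_m.+1)
    (j : 'I_m.+1) (t : R) (x q : 'rV[R]_N.+1) : R :=
  lagrangian H j x q - (B *m u t x) j 0.

Definition viscosity_subsolution (R : realType) (N m : nat)
    (H : 'I_m.+1 -> 'rV[R]_N.+1 -> 'rV[R]_N.+1 -> R) (B : 'M[R]_m.+1)
    (u : R -> 'rV[R]_N.+1 -> 'cV[R]_m.+1) : Prop :=
  forall (i : 'I_m.+1) (phi : R * 'rV[R]_N.+1 -> R) (t : R) (x : 'rV[R]_N.+1),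
    0 < t -> C1_on [set z : R * 'rV[R]_N.+1 | 0 < z.1] phi ->
    (\forall z \near (t, x),
       u z.1 z.2 i 0 - phi z <= u t x i 0 - phi (t, x)) ->
    derive1 (fun s => phi (s, x)) t + H i x (grad (fun y => phi (t, y)) x)
      + (B *m u t x) i 0 <= 0.

Definition viscosity_supersolution (R : realType) (N m : nat)
    (H : 'I_m.+1 -> 'rV[R]_N.+1 -> 'rV[R]_N.+1 -> R) (B : 'M[R]_m.+1)
    (u : R -> 'rV[R]_N.+1 -> 'cV[R]_m.+1) : Prop :=
  forall (i : 'I_m.+1) (phi : R * 'rV[R]_N.+1 -> R) (t : R) (x : 'rV[R]_N.+1),
    0 < t -> C1_on [set z : R * 'rV[R]_N.+1 | 0 < z.1] phi ->
    (\forall z \near (t, x),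
       u t x i 0 - phi (t, x) <= u z.1 z.2 i 0 - phi z) ->
    0 <= derive1 (fun s => phi (s, x)) t + H i x (grad (fun y => phi (t, y)) x)
      + (B *m u t x) i 0.

(* Values of u at negative times are irrelevant. *)
Definition cauchy_solution (R : realType) (N m : nat)
    (H : 'I_m.+1 -> 'rV[R]_N.+1 -> 'rV[R]_N.+1 -> R) (B : 'M[R]_m.+1)
    (u0 : 'rV[R]_N.+1 -> 'cV[R]_m.+1)
    (u : R -> 'rV[R]_N.+1 -> 'cV[R]_m.+1) : Prop :=
  [/\ viscosity_subsolution H B u, viscosity_supersolution H B u,
      forall x, u 0 x = u0 x &
      forall S : R, 0 < S ->
        bounded_set [set u t x | t in `[0, S]%classic & x in [set: 'rV[R]_N.+1]]
        /\ unif_continuous_on [set z | 0 <= z.1 <= S]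
             (fun z : R * 'rV[R]_N.+1 => u z.1 z.2)].

(* A path on [0, +oo) with values in a discrete space: convergence means being
   eventually constant.  So that two paths agreeing on [0, +oo) are equal, paths
   are extended to negative times by their value at 0; the extension creates
   no discontinuity. *)
Definition cadlag (R : realType) (m : nat) (w : R -> 'I_m.+1) : Prop :=
  [/\ forall t, t < 0 -> w t = w 0,
      forall t, 0 <= t -> \forall s \near t^'+, w s = w t &
      forall t, 0 < t -> exists j, \forall s \near t^'-, w s = j].

Record mode_path (R : realType) (m : nat) := Path {
  path_fun :> R -> 'I_m.+1;
  path_cadlag : cadlag path_fun }.

Lemma cadlag_cst (R : realType) (m : nat) : @cadlag R m (fun=> ord0).
Proof.
split=> // t _; first exact: nearW.
by exists ord0; exact: nearW.
Qed.

HB.instance Definition _ (R : realType) (m : nat) := gen_eqMixin (mode_path R m).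
HB.instance Definition _ (R : realType) (m : nat) := gen_choiceMixin (mode_path R m).
HB.instance Definition _ (R : realType) (m : nat) :=
  isPointed.Build (mode_path R m) (Path (@cadlag_cst R m)).

(* The sigma-algebra on paths is generated by the evaluations at times t >= 0. *)
Definition evaluation_events (R : realType) (m : nat) : set (set (mode_path R m)) :=
  [set A | exists (t : R) (j : 'I_m.+1),
     0 <= t /\ A = [set w : mode_path R m | w t = j]].

HB.instance Definition _ (R : realType) (m : nat) :=
  Measurable.copy (mode_path R m) (g_sigma_algebraType (@evaluation_events R m)).

Definition jump_time (R : realType) (m : nat) (w : mode_path R m) (t : R) : Prop :=
  ~ (\forall s \near t, w s = w t).

Definition left_limit (R : realType) (m : nat) (w : mode_path R m) (t : R)
    (j : 'I_m.+1) : Prop :=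
  \forall s \near t^'-, w s = j.

Definition start_at (R : realType) (m : nat) (i : 'I_m.+1) : set (mode_path R m) :=
  [set w | w 0 = i].

Lemma measurable_start_at (R : realType) (m : nat) (i : 'I_m.+1) :
  measurable (@start_at R m i).
Proof. by apply: sub_sigma_algebra; exists 0, i. Qed.

(* Markov property with transition matrices e^{-B t}, in product form. *)
Definition markov_chain (R : realType) (m : nat) (B : 'M[R]_m.+1)
    (P : probability (mode_path R m) R) : Prop :=
  forall (n : nat) (t : nat -> R) (k : nat -> 'I_m.+1),
    0 <= t 0%N -> (forall l, (l <= n)%N -> t l < t l.+1) ->
    (P [set w | forall l, (l <= n.+1)%N -> w (t l) = k l] =
     P [set w | forall l, (l <= n)%N -> w (t l) = k l] *
       (expmx (- (t n.+1 - t n) *: B) (k n) (k n.+1))%:E)%E.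

(* P_i, i.e. A |-> P (A `&` start_at i) / P (start_at i). *)
Definition cond_start (R : realType) (m : nat) (P : probability (mode_path R m) R)
    (i : 'I_m.+1) : probability (mode_path R m) R :=
  mnormalize (mrestr P (@measurable_start_at R m i)) P.

(* A curve on [0, T] is represented by a function R -> 'rV[R]_N.+1 of which only
   the restriction to [0, T] matters: the topology of {uniform` `[0, T] -> _} is
   the initial one for that restriction, so the second condition is Borel
   measurability into C([0, T]; R^N) with the sup norm. *)
Definition admissible (R : realType) (N m : nat) (T : R) (x : 'rV[R]_N.+1)
    (eta : mode_path R m -> R -> 'rV[R]_N.+1) : Prop :=
  [/\ forall w, {within `[0, T], continuous (eta w)},
      forall U : set {uniform` `[0, T]%classic -> 'rV[R]_N.+1},
        open U -> measurable [set w | U (eta w)],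
      forall w, eta w 0 = x,
      forall e : R, 0 < e -> exists2 d : R, 0 < d &
        forall (n : nat) (a b : 'I_n -> R),
          (forall j, [/\ 0 <= a j, a j <= b j & b j <= T]) ->
          trivIset setT (fun j => `]a j, b j[%classic) ->
          \sum_(j < n) (b j - a j) < d ->
          forall w, \sum_(j < n) enorm (eta w (b j) - eta w (a j)) < e &
      forall t, 0 <= t <= T -> forall w1 w2 : mode_path R m,
        (forall s, 0 <= s <= t -> w1 s = w2 s) ->
        forall s, 0 <= s <= t -> eta w1 s = eta w2 s].

Definition lax_oleinik (R : realType) (N m : nat)
    (H : 'I_m.+1 -> 'rV[R]_N.+1 -> 'rV[R]_N.+1 -> R)
    (u0 : 'rV[R]_N.+1 -> 'cV[R]_m.+1) (P : probability (mode_path R m) R)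
    (i : 'I_m.+1) (T : R) (eta : mode_path R m -> R -> 'rV[R]_N.+1) : \bar R :=
  (\int[cond_start P i]_w
     ((u0 (eta w T) (w T) 0%R)%:E +
      \int[lebesgue_measure]_(s in `[0%R, T])
        (lagrangian H (w s) (eta w s) (- derive1 (eta w) s))%:E))%E.

Definition minimizes (R : realType) (N m : nat)
    (H : 'I_m.+1 -> 'rV[R]_N.+1 -> 'rV[R]_N.+1 -> R)
    (u0 : 'rV[R]_N.+1 -> 'cV[R]_m.+1) (P : probability (mode_path R m) R)
    (u : R -> 'rV[R]_N.+1 -> 'cV[R]_m.+1)
    (i : 'I_m.+1) (T : R) (x : 'rV[R]_N.+1)
    (eta : mode_path R m -> R -> 'rV[R]_N.+1) : Prop :=
  [/\ admissible T x eta,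
      (u T x i 0)%:E = lax_oleinik H u0 P i T eta &
      lax_oleinik H u0 P i T eta =
        ereal_inf [set lax_oleinik H u0 P i T gamma
                  | gamma in admissible T x]].

Definition calibrated (R : realType) (N m : nat)
    (H : 'I_m.+1 -> 'rV[R]_N.+1 -> 'rV[R]_N.+1 -> R) (B : 'M[R]_m.+1)
    (u : R -> 'rV[R]_N.+1 -> 'cV[R]_m.+1) (T : R)
    (eta : mode_path R m -> R -> 'rV[R]_N.+1) (w : mode_path R m) : Prop :=
  forall (a b : R) (j : 'I_m.+1),
    0 <= a -> a < b -> b <= T -> (forall s, a <= s < b -> w s = j) ->
    ((u (T - a) (eta w a) j 0 - u (T - b) (eta w b) j 0)%:E =
     \int[lebesgue_measure]_(s in `[a, b])
       (lagrangianG H B u j (T - s) (eta w s) (- derive1 (eta w) s))%:E)%E.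

Definition regular_off_jumps (R : realType) (N m : nat) (T : R)
    (eta : mode_path R m -> R -> 'rV[R]_N.+1) (w : mode_path R m) : Prop :=
  forall t, 0 < t < T ->
    (~ jump_time w t ->
       derivable (eta w) t 1 /\ {for t, continuous (derive1 (eta w))}) /\
    (jump_time w t ->
       cvg (left_quotient_limit (eta w) t) /\
       cvg (right_quotient_limit (eta w) t)).

(* s is the time T - t of the solution, v the (left) velocity of the curve at t. *)
Definition differentiable_along (R : realType) (N m : nat)
    (H : 'I_m.+1 -> 'rV[R]_N.+1 -> 'rV[R]_N.+1 -> R) (B : 'M[R]_m.+1)
    (u : R -> 'rV[R]_N.+1 -> 'cV[R]_m.+1) (j : 'I_m.+1)
    (s : R) (y v : 'rV[R]_N.+1) : Prop :=
  [/\ differentiable (fun z : R * 'rV[R]_N.+1 => u z.1 z.2 j 0) (s, y),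
      grad (fun y' => u s y' j 0) y = grad (lagrangian H j y) (- v) &
      derive1 (fun s' => u s' y j 0) s =
        - H j y (grad (fun y' => u s y' j 0) y) - (B *m u s y) j 0].

(* Main.v *)
Require Import Defs.
From HB Require Import structures.
From mathcomp Require Import all_boot all_order all_algebra.
From mathcomp Require Import all_classical all_reals all_analysis.
From mathcomp Require Import ring lra.
Import Order.TTheory GRing.Theory Num.Theory.
Import numFieldNormedType.Exports.
Local Open Scope classical_set_scope.
Local Open Scope ring_scope.

Set Implicit Arguments.
Unset Strict Implicit.
Unset Printing Implicit Defensive.

(* Write [z0 = (T - t, eta t)], [j] for the mode just before [t], [v] for minus the
   left velocity of [eta] at [t], [p] for the maximizer of [p . v - H_j], [G] for [H_j]
   plus the coupling term and [q = - G z0 p].  Let [W z] be [u_j z - u_j z0] minus the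
   linear form [(q, p)] at [z - z0]; the claim is [W z = o(|z - z0|)].
   - The subsolution property bounds the increments of [u_j] along short segments by
     the frozen Lagrangian, whose differential at [v] is [p] because [H_j] is strictly
     convex.
   - Lower bound: just before [t] the calibrated curve gives
     [W (z0 + s (1, v)) >= - o(s)] for [s > 0], and the segment bound carries this back
     to every [z] near [z0], through the point with [s = C |z - z0|], [C] large.
   - Upper bound: by the lower bound [W >= - o(|z - z0|)], and [W z0 = 0].  The
     supersolution property then forces [W (z0 - s (1, v)) <= o(s)]: values of order
     [s] would propagate forward along the characteristic direction [v = D_p H_j] up to
     [z0].  The segment bound carries this forward to every [z] near [z0], from the
     point with [s = C |z - z0|].
   Only the part of the curve before [t] enters, so jump times need no separate
   treatment. *)

(** * The Euclidean pairing *)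

Lemma dotC (R : realType) n (p q : 'rV[R]_n) : dot p q = dot q p.
Proof. by apply: eq_bigr => k _; rewrite mulrC. Qed.

Lemma dotDl (R : realType) n (p p' q : 'rV[R]_n) :
  dot (p + p') q = dot p q + dot p' q.
Proof. by rewrite /dot -big_split; apply: eq_bigr => k _; rewrite mxE mulrDl. Qed.

Lemma dotZl (R : realType) n (a : R) (p q : 'rV[R]_n) :
  dot (a *: p) q = a * dot p q.
Proof. by rewrite /dot mulr_sumr; apply: eq_bigr => k _; rewrite mxE mulrA. Qed.

Lemma dotNl (R : realType) n (p q : 'rV[R]_n) : dot (- p) q = - dot p q.
Proof. by rewrite -scaleN1r dotZl mulN1r. Qed.

Lemma dotBl (R : realType) n (p p' q : 'rV[R]_n) :
  dot (p - p') q = dot p q - dot p' q.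
Proof. by rewrite dotDl dotNl. Qed.

Lemma dotDr (R : realType) n (p q q' : 'rV[R]_n) :
  dot p (q + q') = dot p q + dot p q'.
Proof. by rewrite ![dot p _]dotC dotDl. Qed.

Lemma dotZr (R : realType) n (a : R) (p q : 'rV[R]_n) :
  dot p (a *: q) = a * dot p q.
Proof. by rewrite ![dot p _]dotC dotZl. Qed.

Lemma dotNr (R : realType) n (p q : 'rV[R]_n) : dot p (- q) = - dot p q.
Proof. by rewrite ![dot p _]dotC dotNl. Qed.

Lemma dotBr (R : realType) n (p q q' : 'rV[R]_n) :
  dot p (q - q') = dot p q - dot p q'.
Proof. by rewrite dotDr dotNr. Qed.

Lemma dot0l (R : realType) n (q : 'rV[R]_n) : dot 0 q = 0.
Proof. by rewrite -(scale0r q) dotZl mul0r. Qed.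

Lemma dot0r (R : realType) n (q : 'rV[R]_n) : dot q 0 = 0.
Proof. by rewrite dotC dot0l. Qed.

Lemma dot_delta (R : realType) n (p : 'rV[R]_n) (k : 'I_n) :
  dot p (delta_mx 0 k) = p 0 k.
Proof.
rewrite /dot (bigD1 k) //= mxE !eqxx mulr1 big1 ?addr0 // => l lk.
by rewrite mxE eqxx (negbTE lk) mulr0.
Qed.

Lemma dot_ge0 (R : realType) n (p : 'rV[R]_n) : 0 <= dot p p.
Proof. by apply: sumr_ge0 => k _; rewrite -expr2 sqr_ge0. Qed.

Lemma sqr_enorm (R : realType) n (p : 'rV[R]_n) : enorm p ^+ 2 = dot p p.
Proof. by rewrite sqr_sqrtr ?dot_ge0. Qed.

Lemma enorm_ge0 (R : realType) n (p : 'rV[R]_n) : 0 <= enorm p.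
Proof. exact: sqrtr_ge0. Qed.

Lemma normr_coord_le (R : realType) n (p : 'rV[R]_n.+1) (k : 'I_n.+1) :
  `|p 0 k| <= `|p|.
Proof.
rewrite [leRHS]/Num.norm/= mx_normrE.
exact: (le_bigmax _ (fun ij : 'I_1 * 'I_n.+1 => `|p ij.1 ij.2|) (0, k)).
Qed.

Lemma normr_dot_le (R : realType) n (p q : 'rV[R]_n.+1) :
  `|dot p q| <= n.+1%:R * `|p| * `|q|.
Proof.
apply: le_trans (ler_norm_sum _ _ _) _.
apply: (@le_trans _ _ (\sum_(k < n.+1) `|p| * `|q|)).
  by apply: ler_sum => k _; rewrite normrM ler_pM ?normr_coord_le.
by rewrite sumr_const card_ord -mulrA mulr_natl.
Qed.

Lemma normr_le_enorm (R : realType) n (p : 'rV[R]_n.+1) : `|p| <= enorm p.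
Proof.
rewrite [leLHS]/Num.norm/= mx_normrE; apply: bigmax_le; first exact: enorm_ge0.
move=> [i k] _ /=; rewrite (ord1 i).
rewrite -(@ler_pXn2r _ 2) ?nnegrE ?enorm_ge0 // sqr_enorm real_normK ?num_real//.
rewrite /dot (bigD1 k) //= expr2 lerDl.
by apply: sumr_ge0 => l _; rewrite -expr2 sqr_ge0.
Qed.

Lemma enorm_le_normr (R : realType) n (p : 'rV[R]_n.+1) :
  enorm p <= n.+1%:R * `|p|.
Proof.
rewrite -(@ler_pXn2r _ 2) ?nnegrE ?enorm_ge0 ?mulr_ge0 // sqr_enorm.
apply: le_trans (ler_norm _) (le_trans (normr_dot_le p p) _).
rewrite exprMn -mulrA -expr2 ler_wpM2r ?sqr_ge0 // expr2 -natrM ler_nat.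
by rewrite leq_pmulr.
Qed.

Lemma sqr_normr_le_dot (R : realType) n (p : 'rV[R]_n.+1) : `|p| ^+ 2 <= dot p p.
Proof. by rewrite -sqr_enorm ler_pXn2r ?nnegrE ?enorm_ge0 ?normr_le_enorm. Qed.

(** * First-order expansions *)

(** With its converse [diff_expansion], this trades little-o notation for explicit thresholds, the
    form in which the estimates below are made. *)
Lemma is_diff_expansion (R : realType) (V W : normedModType R) (f : V -> W)
    (df : {linear V -> W}) (z : V) : continuous df ->
  (forall e : R, 0 < e -> exists2 d : R, 0 < d & forall h, `|h| < d ->
     `|f (z + h) - f z - df h| <= e * `|h|) ->
  is_diff z f df.
Proof.
move=> cdf fE.
have fo : f \o shift z = cst (f z) + df +o_ 0 id.
  apply/eqaddoP => e e0; have [d d0 dP] := fE e e0.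
  apply/nbhs_normP; exists d => //= h /=; rewrite sub0r normrN => hd.
  by have := dP _ hd; rewrite -addrA -opprD [z + h]addrC.
have dE := diff_unique cdf fo; apply: DiffDef => //.
by apply/diff_locallyP; rewrite dE; split.
Qed.

Lemma diff_expansion (R : realType) (V W : normedModType R) (f : V -> W) (z : V) :
  differentiable f z -> forall e : R, 0 < e -> exists2 d : R, 0 < d &
    forall h, `|h| < d -> `|f (z + h) - f z - 'd f z h| <= e * `|h|.
Proof.
move=> /diff_locallyP[_ /eqaddoP fo] e e0.
have /nbhs_normP[d /= d0 dP] := fo e e0; exists d => // h hd.
by rewrite -addrA -opprD [z + h]addrC; apply: dP; rewrite /= sub0r normrN.
Qed.

Lemma continuous_dist (R : realType) (V W : normedModType R) (f : V -> W) (z : V) :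
  {for z, continuous f} <-> forall e : R, 0 < e -> exists2 d : R, 0 < d &
    forall h, `|h| < d -> `|f (z + h) - f z| < e.
Proof.
split=> [/cvgrPdist_lt fz e e0|fz].
  have /nbhs_normP[d /= d0 dP] := fz e e0; exists d => // h hd.
  by rewrite distrC; apply: dP; rewrite /= opprD addNKr normrN.
apply/cvgrPdist_lt => e e0; have [d d0 dP] := fz e e0.
apply/nbhs_normP; exists d => //= w zw.
by rewrite distrC -[w](subrKC z); apply: dP; rewrite distrC.
Qed.

Lemma normr_affine_part_le (R : realType) n (a : R) (p : 'rV[R]_n.+1)
    (z : R * 'rV[R]_n.+1) :
  `|a * z.1 + dot p z.2| <= (`|a| + n.+1%:R * `|p|) * `|z|.
Proof.
apply: le_trans (ler_normD _ _) _; rewrite mulrDl lerD //.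
  by rewrite normrM ler_wpM2l // prod_normE le_max lexx.
apply: le_trans (normr_dot_le _ _) _.
by rewrite ler_wpM2l ?mulr_ge0 // prod_normE le_max lexx orbT.
Qed.

(** A linear form on space-time, the linear part of an affine function. The codomain [R^o] is [R] as
    a module over itself, so that the form can serve as a differential. *)
Definition affine_part (R : realType) n (a : R) (p : 'rV[R]_n) (z : R * 'rV[R]_n) : R^o :=
  a * z.1 + dot p z.2.

Lemma affine_part_linear (R : realType) n (a : R) (p : 'rV[R]_n) :
  linear (affine_part a p).
Proof.
move=> k y z; rewrite /affine_part /= dotDr dotZr.
by rewrite -[k *: (_ : R^o)]/(k * _) -[k *: y.1]/(k * _); ring.
Qed.
HB.instance Definition _ (R : realType) n (a : R) (p : 'rV[R]_n) :=
  GRing.isLinear.Build R (R * 'rV[R]_n)%type R^o _ (affine_part a p)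
    (affine_part_linear a p).

Lemma affine_part_continuous (R : realType) n (a : R) (p : 'rV[R]_n.+1) :
  continuous (affine_part a p).
Proof.
move=> z; apply/continuous_dist => e e0.
have c0 : 0 < `|a| + n.+1%:R * `|p| + 1 by rewrite ltr_wpDl ?addr_ge0 ?mulr_ge0.
exists (e / (`|a| + n.+1%:R * `|p| + 1)) => [|h]; first by rewrite divr_gt0.
rewrite ltr_pdivlMr // => zw; rewrite linearD addrC addKr.
apply: le_lt_trans (normr_affine_part_le _ _ _) _; apply: le_lt_trans zw.
by rewrite mulrC ler_wpM2l // lerDl.
Qed.

Lemma is_diff_affine (R : realType) n (f : R * 'rV[R]_n.+1 -> R) z (a : R)
    (p : 'rV[R]_n.+1) :
  (forall e : R, 0 < e -> exists2 d : R, 0 < d & forall h, `|h| < d ->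
     `|f (z + h) - f z - (a * h.1 + dot p h.2)| <= e * `|h|) ->
  is_diff z (f : _ -> R^o) (affine_part a p).
Proof.
by move=> fE; apply: is_diff_expansion => //; exact: affine_part_continuous.
Qed.

Lemma grad_expansion (R : realType) n (f : 'rV[R]_n.+1 -> R) y (p : 'rV[R]_n.+1) :
  (forall e : R, 0 < e -> exists2 d : R, 0 < d & forall h, `|h| < d ->
     `|f (y + h) - f y - dot p h| <= e * `|h|) ->
  grad f y = p.
Proof.
move=> fE; apply/rowP => k; rewrite mxE.
apply/cvg_lim => //; apply/cvgrPdist_le => e e0.
set v := delta_mx _ _.
have [d d0 dP] := fE (e / (`|v| + 1)) (divr_gt0 e0 (ltr_wpDl (normr_ge0 _) ltr01)).
apply/nbhs_normP; exists (d / (`|v| + 1)); first by rewrite /= divr_gt0 ?ltr_wpDl.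
move=> h /=; rewrite sub0r normrN ltr_pdivlMr ?ltr_wpDl // => hd h0.
have hv : `|h *: v| < d.
  by apply: le_lt_trans hd; rewrite normrZ ler_wpM2l // lerDl.
have := dP _ hv; rewrite dotZr dot_delta -/v.
rewrite [y + _]addrC => H.
rewrite -[X in `|X - _|](mulKf h0) -[_ *: (_ - _)]/(_ * _) -mulrBr normrM distrC normfV.
rewrite ler_pdivrMl ?normr_gt0 // (le_trans H) // normrZ mulrC -mulrA ler_wpM2l //.
by rewrite mulrCA ler_piMr ?(ltW e0) // ler_pdivrMr ?ltr_wpDl // mul1r lerDl.
Qed.

Lemma is_derive_expansion (R : realType) (f : R -> R) s (a : R) :
  (forall e : R, 0 < e -> exists2 d : R, 0 < d & forall h, `|h| < d ->
     `|f (s + h) - f s - a * h| <= e * `|h|) ->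
  is_derive s 1 f a.
Proof.
move=> fE; suff fa : h^-1 *: ((f \o shift s) (h *: 1) - f s) @[h --> 0^'] --> a.
  by apply: DeriveDef; [apply/cvg_ex; exists a | apply/cvg_lim].
apply/cvgrPdist_le => e e0; have [d d0 dP] := fE e e0.
apply/nbhs_normP; exists d => // h; rewrite /= sub0r normrN => hd h0.
have := dP _ hd; rewrite [s + _]addrC => H.
rewrite -[X in `|X - _|](mulKf h0) -[_ *: (_ - _)]/(_ * _) -mulrBr normrM distrC normfV.
by rewrite ler_pdivrMl ?normr_gt0 // -[h *: 1]/(h * 1) mulr1 [h * a]mulrC [leRHS]mulrC.
Qed.

Lemma expansion_space (R : realType) n (f : R * 'rV[R]_n.+1 -> R) s y (a : R)
    (p : 'rV[R]_n.+1) :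
  (forall e : R, 0 < e -> exists2 d : R, 0 < d & forall h, `|h| < d ->
     `|f ((s, y) + h) - f (s, y) - (a * h.1 + dot p h.2)| <= e * `|h|) ->
  grad (fun y' => f (s, y')) y = p.
Proof.
move=> fE; apply: grad_expansion => e e0; have [d d0 dP] := fE e e0.
exists d => // h hd; have := dP (0, h).
have -> : (s, y) + (0, h) = (s, y + h) by congr pair; exact: addr0.
by rewrite /= mulr0 add0r prod_normE /= normr0 (max_idPr _) //; apply.
Qed.

Lemma expansion_time (R : realType) n (f : R * 'rV[R]_n.+1 -> R) s y (a : R)
    (p : 'rV[R]_n.+1) :
  (forall e : R, 0 < e -> exists2 d : R, 0 < d & forall h, `|h| < d ->
     `|f ((s, y) + h) - f (s, y) - (a * h.1 + dot p h.2)| <= e * `|h|) ->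
  derive1 (fun s' => f (s', y)) s = a.
Proof.
move=> fE; rewrite derive1E; apply: derive_val.
apply: is_derive_expansion => e e0; have [d d0 dP] := fE e e0.
exists d => // h hd; have := dP (h, 0).
have -> : (s, y) + (h, 0) = (s + h, y) by congr pair; exact: addr0.
by rewrite /= dot0r addr0 prod_normE /= normr0 (max_idPl _) //; apply.
Qed.

Lemma lipschitz_continuous_at (R : realType) (V W : normedModType R) (f : V -> W)
    (z : V) (C : R) :
  (forall h, `|f (z + h) - f z| <= C * `|h|) -> {for z, continuous f}.
Proof.
move=> fC; apply/continuous_dist => e e0.
have c0 : 0 < `|C| + 1 by rewrite ltr_wpDl.
exists (e / (`|C| + 1)) => [|h]; first by rewrite divr_gt0.
rewrite ltr_pdivlMr // => he; apply: le_lt_trans (fC h) (le_lt_trans _ he).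
by rewrite mulrC ler_wpM2l // ler_wpDr // ler_norm.
Qed.

(** * Test functions *)

(** Position relative to an observer who leaves [y1] at time [s1] with constant velocity [w]. *)
Definition moving_frame (R : realType) n (s1 : R) (y1 w : 'rV[R]_n)
    (z : R * 'rV[R]_n) : 'rV[R]_n := z.2 - y1 - (z.1 - s1) *: w.

Lemma moving_frameD (R : realType) n (s1 : R) (y1 w : 'rV[R]_n) z h :
  moving_frame s1 y1 w (z + h) = moving_frame s1 y1 w z + (h.2 - h.1 *: w).
Proof.
rewrite /moving_frame /=.
by apply/rowP => k; rewrite !mxE; ring.
Qed.

Lemma moving_frame_lip (R : realType) n (w : 'rV[R]_n.+1) (h : R * 'rV[R]_n.+1) :
  `|h.2 - h.1 *: w| <= (1 + `|w|) * `|h|.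
Proof.
apply: le_trans (ler_normB _ _) _; rewrite mulrDl mul1r normrZ prod_normE.
by rewrite lerD ?le_max ?lexx ?orbT // mulrC ler_wpM2l // le_max lexx.
Qed.

Definition test_function (R : realType) n (A : R) (p : 'rV[R]_n) (K M s1 s2 : R)
    (y1 w : 'rV[R]_n) (z : R * 'rV[R]_n) : R :=
  A * z.1 + dot p z.2
  + K * dot (moving_frame s1 y1 w z) (moving_frame s1 y1 w z)
  + M * Num.max (z.1 - s2) 0 ^+ 2.

(** The middle term comes from the motion of the paraboloid. In both viscosity estimates it cancels
    the part of the Hamiltonian that is linear in the gradient of the paraboloid. *)
Definition test_dt (R : realType) n (A K M s1 s2 : R) (y1 w : 'rV[R]_n)
    (z : R * 'rV[R]_n) : R :=
  A - 2 * K * dot (moving_frame s1 y1 w z) w + 2 * M * Num.max (z.1 - s2) 0.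

Definition test_dx (R : realType) n (p : 'rV[R]_n) (K s1 : R) (y1 w : 'rV[R]_n)
    (z : R * 'rV[R]_n) : 'rV[R]_n :=
  p + (2 * K) *: moving_frame s1 y1 w z.

Lemma sqr_pospart_expansion (R : realType) (a h : R) :
  `|Num.max (a + h) 0 ^+ 2 - Num.max a 0 ^+ 2 - 2 * Num.max a 0 * h| <= h ^+ 2.
Proof.
rewrite ler_norml; have h2 := sqr_ge0 h; have ah2 := sqr_ge0 (a + h).
have [ah|ah] := leP (a + h) 0;
have [a0|a0] := leP a 0; apply/andP; split; nra.
Qed.

Lemma pospart_lip (R : realType) (a h : R) :
  `|Num.max (a + h) 0 - Num.max a 0| <= `|h|.
Proof.
rewrite ler_norml; have h1 := ler_norm h; have := ler_norm (- h).
rewrite normrN => h2.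
by have [ah|ah] := leP (a + h) 0; have [a0|a0] := leP a 0; apply/andP; split; lra.
Qed.

Lemma test_function_expansion (R : realType) n (A : R) (p : 'rV[R]_n.+1)
    (K M s1 s2 : R) (y1 w : 'rV[R]_n.+1) (z : R * 'rV[R]_n.+1) (e : R) :
  0 < e -> exists2 d : R, 0 < d & forall h, `|h| < d ->
  `|test_function A p K M s1 s2 y1 w (z + h) - test_function A p K M s1 s2 y1 w z
    - (test_dt A K M s1 s2 y1 w z * h.1 + dot (test_dx p K s1 y1 w z) h.2)|
    <= e * `|h|.
Proof.
move=> e0; set C := `|K| * (n.+1%:R * (1 + `|w|) ^+ 2) + `|M| + 1.
have C0 : 0 < C by rewrite ltr_wpDl // addr_ge0 // !mulr_ge0 // exprn_ge0 // addr_ge0.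
exists (e / C) => [|h hd]; first by rewrite divr_gt0.
set e' := h.2 - h.1 *: w.
(* The first-order terms cancel exactly; what remains is quadratic in [h], and [C] bounds its
   size. *)
have -> : test_function A p K M s1 s2 y1 w (z + h) - test_function A p K M s1 s2 y1 w z
    - (test_dt A K M s1 s2 y1 w z * h.1 + dot (test_dx p K s1 y1 w z) h.2)
  = K * dot e' e' + M * (Num.max (z.1 - s2 + h.1) 0 ^+ 2 - Num.max (z.1 - s2) 0 ^+ 2
     - 2 * Num.max (z.1 - s2) 0 * h.1).
  rewrite /test_function /test_dt /test_dx moving_frameD -/e' /=.
  have -> : z.1 + h.1 - s2 = z.1 - s2 + h.1 by ring.
  have -> : h.2 = e' + h.1 *: w by rewrite subrK.
  move: (moving_frame s1 y1 w z) => Z; clearbody e'.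
  rewrite ?(dotDl, dotDr, dotZl, dotZr) (dotC e' Z); ring.
apply: (@le_trans _ _ (C * `|h| ^+ 2)); last first.
  rewrite expr2 mulrA ler_wpM2r //.
  by move: hd; rewrite ltr_pdivlMr // mulrC => /ltW.
have h1 : `|h.1| <= `|h| by rewrite prod_normE le_max lexx.
apply: le_trans (ler_normD _ _) _; rewrite /C [leRHS]mulrDl mul1r.
apply: ler_wpDr; first exact: sqr_ge0.
rewrite [leRHS]mulrDl lerD // normrM.
  rewrite -[leRHS]mulrA ler_wpM2l // -[leRHS]mulrA.
  apply: le_trans (normr_dot_le _ _) _; rewrite -[leLHS]mulrA -expr2 ler_wpM2l //.
  rewrite -exprMn lerXn2r ?nnegrE ?mulr_ge0 ?addr_ge0 //.
  exact: moving_frame_lip.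
rewrite ler_wpM2l //; apply: le_trans (sqr_pospart_expansion _ _) _.
by rewrite -(real_normK (num_real h.1)) lerXn2r ?nnegrE.
Qed.

Lemma test_function_C1 (R : realType) n (A : R) (p : 'rV[R]_n.+1)
    (K M s1 s2 : R) (y1 w : 'rV[R]_n.+1) (D : set (R * 'rV[R]_n.+1)) :
  C1_on D (test_function A p K M s1 s2 y1 w).
Proof.
set f := test_function _ _ _ _ _ _ _ _.
have dif z : is_diff z (f : _ -> R^o)
    (affine_part (test_dt A K M s1 s2 y1 w z) (test_dx p K s1 y1 w z)).
  by apply: is_diff_affine => e; exact: test_function_expansion.
move=> z _; split=> [|v]; first by have [] := dif z.
have -> : 'D_v f = fun z => test_dt A K M s1 s2 y1 w z * v.1
                            + dot (test_dx p K s1 y1 w z) v.2.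
  by apply/funext => x; have [df dE] := dif x; rewrite deriveE // dE.
apply: (@lipschitz_continuous_at _ _ _ _ _
  ((2 * `|K| * (n.+1%:R * ((1 + `|w|) * `|w|)) + 2 * `|M|) * `|v.1|
   + 2 * `|K| * (n.+1%:R * ((1 + `|w|) * `|v.2|)))) => h.
set e' := h.2 - h.1 *: w.
have -> : test_dt A K M s1 s2 y1 w (z + h) * v.1
    + dot (test_dx p K s1 y1 w (z + h)) v.2
    - (test_dt A K M s1 s2 y1 w z * v.1 + dot (test_dx p K s1 y1 w z) v.2)
  = (- (2 * K * dot e' w)
     + 2 * M * (Num.max (z.1 - s2 + h.1) 0 - Num.max (z.1 - s2) 0)) * v.1
    + 2 * K * dot e' v.2.
  rewrite /test_dt /test_dx moving_frameD -/e' /=.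
  have -> : z.1 + h.1 - s2 = z.1 - s2 + h.1 by ring.
  move: (moving_frame s1 y1 w z) => Z; clearbody e'.
  rewrite ?(dotDl, dotZl); ring.
have eh : `|e'| <= (1 + `|w|) * `|h| by exact: moving_frame_lip.
have h1 : `|h.1| <= `|h| by rewrite prod_normE le_max lexx.
have dE x : `|2 * K * dot e' x| <= 2 * `|K| * (n.+1%:R * ((1 + `|w|) * `|x|)) * `|h|.
  rewrite !normrM (ger0_norm (ler0n _ _)) -[leRHS]mulrA ler_wpM2l ?mulr_ge0 //.
  apply: le_trans (normr_dot_le _ _) _; rewrite -!mulrA ler_wpM2l //.
  apply: (le_trans (ler_wpM2r (normr_ge0 x) eh)).
  by rewrite -mulrA [`|h| * _]mulrC mulrA.
apply: le_trans (ler_normD _ _) _; rewrite [leRHS]mulrDl lerD ?dE //.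
rewrite normrM [leRHS]mulrAC ler_wpM2r //.
apply: le_trans (ler_normD _ _) _; rewrite [leRHS]mulrDl normrN lerD ?dE //.
rewrite normrM [`|2 * M|]normrM (ger0_norm (ler0n _ _)) ler_wpM2l ?mulr_ge0 //.
exact: le_trans (pospart_lip _ _) h1.
Qed.

(** * Maxima over slanted space-time boxes *)

Lemma compact_normr_ball (R : realType) n (r : R) :
  compact [set y : 'rV[R]_n.+1 | `|y| <= r].
Proof.
apply: bounded_closed_compact.
  exists r; split; first exact: num_real.
  by move=> M rM y /= yr; exact: le_trans yr (ltW rM).
apply: (@preimage_closed _ _ (fun y : 'rV[R]_n.+1 => `|y|) [set x | x <= r]).
  by move=> y _; exact: norm_continuous.
exact: closed_le.
Qed.

Definition moving_box (R : realType) n (s1 s3 rho : R) (y1 w : 'rV[R]_n.+1) :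
    set (R * 'rV[R]_n.+1) :=
  [set z | s1 <= z.1 <= s3 /\ `|moving_frame s1 y1 w z| <= rho].

(** The chart [fr] straightens the slanted box into the product of a segment and a closed ball,
    which is compact. *)
Lemma moving_box_max (R : realType) n (s1 s3 rho : R) (y1 w : 'rV[R]_n.+1)
    (g : R * 'rV[R]_n.+1 -> R) : s1 <= s3 -> 0 <= rho ->
  (forall z, moving_box s1 s3 rho y1 w z -> {for z, continuous g}) ->
  exists2 z, moving_box s1 s3 rho y1 w z &
    forall z', moving_box s1 s3 rho y1 w z' -> g z' <= g z.
Proof.
move=> s13 rho0 cg.
pose fr (z : R * 'rV[R]_n.+1) := (z.1, y1 + (z.1 - s1) *: w + z.2).
pose A : set (R * 'rV[R]_n.+1) := `[s1, s3]%classic `*` [set y | `|y| <= rho].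
have frK z : moving_frame s1 y1 w (fr z) = z.2.
  by rewrite /moving_frame /fr /=; apply/rowP => k; rewrite !mxE; ring.
have Kfr z : fr (z.1, moving_frame s1 y1 w z) = z.
  rewrite /moving_frame /fr /=; case: z => s y /=; congr pair.
  by apply/rowP => k; rewrite !mxE; ring.
have cfr z : {for z, continuous fr}.
  apply: (@lipschitz_continuous_at _ _ _ _ _ (1 + `|w|)) => h.
  have -> : fr (z + h) - fr z = (h.1, h.2 - (- h.1) *: w).
    rewrite /fr /=; congr pair; first by rewrite /= addrC addKr.
    by apply/rowP => k; rewrite !mxE /=; ring.
  rewrite prod_normE /= ge_max; apply/andP; split.
    by rewrite mulrDl mul1r ler_wpDr ?mulr_ge0 // prod_normE le_max lexx.
  have := moving_frame_lip w (- h.1, h.2).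
  by rewrite !prod_normE /= normrN.
have Abox z : A z -> moving_box s1 s3 rho y1 w (fr z).
  by case=> /=; rewrite in_itv /= => zs zr; split; rewrite /= ?frK.
have A0 : A !=set0.
  by exists (s1, 0); split; rewrite /= ?normr0 // in_itv /= lexx.
have cA : compact A.
  by apply: compact_setX; [exact: segment_compact | exact: compact_normr_ball].
have cgf : {within A, continuous (g \o fr)}.
  apply: continuous_in_subspaceT => z /set_mem Az.
  by apply: continuous_comp; [exact: cfr | exact/cg/Abox].
have [z /set_mem Az zmax] := compact_EVT_max A0 cA cgf.
exists (fr z) => [|z' [z's z'r]]; first exact: Abox.
rewrite -(Kfr z'); apply: (zmax (_, _)); apply/mem_set.
by split; rewrite //= in_itv.
Qed.

(* The last summand of the penalty keeps the maximum away from the final time;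
   it vanishes up to time [s2]. *)
Lemma interior_max (R : realType) n (f : R * 'rV[R]_n.+1 -> R)
    (s1 s2 s3 rho b K c : R) (y1 w : 'rV[R]_n.+1) :
  s1 < s2 -> s2 < s3 -> 0 < rho -> 0 <= K ->
  (forall z, moving_box s1 s3 rho y1 w z -> {for z, continuous f}) ->
  (forall z, z.1 = s1 -> `|moving_frame s1 y1 w z| <= rho ->
     f z - K * dot (moving_frame s1 y1 w z) (moving_frame s1 y1 w z) < c) ->
  (forall z, s1 <= z.1 <= s3 -> `|moving_frame s1 y1 w z| = rho ->
     f z - b * (z.1 - s1) - K * rho ^+ 2 < c) ->
  c <= f (s2, y1 + (s2 - s1) *: w) - b * (s2 - s1) ->
  exists M z, [/\ 0 <= M, s1 < z.1 < s3, `|moving_frame s1 y1 w z| < rho &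
    \forall z' \near z, f z' - test_function b 0 K M s1 s2 y1 w z'
                        <= f z - test_function b 0 K M s1 s2 y1 w z].
Proof.
move=> s12 s23 rho0 K0 cf ini lat fin.
have ctest M z : {for z, continuous (test_function b 0 K M s1 s2 y1 w)}.
  apply: differentiable_continuous.
  by have [] := @test_function_C1 R n b 0 K M s1 s2 y1 w setT z I.
have cg M z : moving_box s1 s3 rho y1 w z ->
    {for z, continuous (fun z => f z - test_function b 0 K M s1 s2 y1 w z)}.
  by move=> zbox; apply: cvgB; [exact: cf | exact: ctest].
have s13 : s1 <= s3 by apply: ltW; exact: lt_trans s23.
(* A first maximum, taken without penalty, fixes [M]: since [M * (s3 - s2) ^+ 2] exceeds
   [S + b * s1 - c], every value at time [s3] falls below [c - b * s1]. *)
have [z0 z0box z0max] := moving_box_max s13 (ltW rho0) (cg 0).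
pose S := f z0 - test_function b 0 K 0 s1 s2 y1 w z0.
pose M := (`|S + b * s1 - c| + 1) / (s3 - s2) ^+ 2.
have M0 : 0 <= M by rewrite divr_ge0 ?sqr_ge0 // addr_ge0.
have [z zbox zmax] := moving_box_max s13 (ltW rho0) (cg M).
have [/andP[z1s zs3] zrho] := zbox.
(* The competitor is the point of the ray at time [s2], where paraboloid and penalty both vanish.
   Each face of the box is then excluded because the values there lie below this bound. *)
have cz : c - b * s1 <= f z - test_function b 0 K M s1 s2 y1 w z.
  pose z2 : R * 'rV[R]_n.+1 := (s2, y1 + (s2 - s1) *: w).
  have fr0 : moving_frame s1 y1 w z2 = 0.
    by rewrite /moving_frame /=; apply/rowP => k; rewrite !mxE; ring.
  have z2box : moving_box s1 s3 rho y1 w z2.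
    by split; rewrite ?fr0 ?normr0 ?(ltW rho0) //= !ltW.
  apply: le_trans (zmax _ z2box).
  rewrite /test_function fr0 !dot0l mulr0 /= subrr maxxx expr0n mulr0 !addr0.
  by move: fin; rewrite mulrBr; lra.
have testE M' x : test_function b 0 K M' s1 s2 y1 w x = b * x.1
    + K * dot (moving_frame s1 y1 w x) (moving_frame s1 y1 w x)
    + M' * Num.max (x.1 - s2) 0 ^+ 2 by rewrite /test_function dot0l addr0.
have sq0 : 0 <= M * Num.max (z.1 - s2) 0 ^+ 2 by rewrite mulr_ge0 ?sqr_ge0.
have z1 : s1 < z.1.
  rewrite lt_neqAle z1s andbT; apply/negP => /eqP zs.
  by have := ini z (esym zs) zrho; move: cz sq0; rewrite testE -zs; lra.
have z3 : z.1 < s3.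
  rewrite lt_neqAle zs3 andbT; apply/negP => /eqP zs.
  have := z0max _ zbox; rewrite -/S testE mul0r addr0; move: cz; rewrite testE zs.
  have -> : Num.max (s3 - s2) 0 = s3 - s2 by apply/max_idPl; rewrite subr_ge0 ltW.
  rewrite /M divfK ?sqrf_eq0 ?subr_eq0 ?gt_eqF //.
  by have := ler_norm (S + b * s1 - c); lra.
have zr : `|moving_frame s1 y1 w z| < rho.
  rewrite lt_neqAle zrho andbT; apply/negP => /eqP zs.
  have := lat z _ zs; rewrite z1s zs3 => /(_ isT).
  have : K * rho ^+ 2 <= K * dot (moving_frame s1 y1 w z) (moving_frame s1 y1 w z).
    by rewrite ler_wpM2l // -zs sqr_normr_le_dot.
  by move: cz sq0; rewrite testE; lra.
exists M, z; split; rewrite ?z1 //.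
(* Distances to the initial and final times, and to the lateral face; [1 + |w|] is the Lipschitz
   constant of the moving frame. *)
pose d := Num.min (Num.min (z.1 - s1) (s3 - z.1))
  ((rho - `|moving_frame s1 y1 w z|) / (1 + `|w|)).
have w1 : 0 < 1 + `|w| by rewrite ltr_wpDr.
have d0 : 0 < d by rewrite !lt_min !subr_gt0 z1 z3 divr_gt0 // subr_gt0.
apply/nbhs_normP; exists d => //= z' zz'; apply: zmax.
pose h := z' - z; have z'E : z' = z + h by rewrite subrKC.
have hd : `|h| < d by rewrite distrC.
clearbody h; move: hd; rewrite !lt_min ltr_pdivlMr // => /andP[/andP[h1 h3] hr].
have hh : `|h.1| <= `|h| by rewrite prod_normE le_max lexx.
have hh1 := ler_norm h.1; have hh2 := ler_norm (- h.1); rewrite normrN in hh2.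
split.
  have -> : z'.1 = z.1 + h.1 by rewrite z'E.
  by apply/andP; split; lra.
rewrite z'E moving_frameD; apply: le_trans (ler_normD _ _) _.
by have := moving_frame_lip w h; lra.
Qed.

(** * Convex conjugates *)

(** Equivalently, [q] is a subgradient of [F] at [p]. *)
Definition dot_maximizer (R : realType) n (F : 'rV[R]_n -> R) (q p : 'rV[R]_n) : Prop :=
  forall p', dot p' q - F p' <= dot p q - F p.

(** The Legendre transform; [lagrangian H j y] unfolds to [conjugate (H j y)]. *)
Definition conjugate (R : realType) n (F : 'rV[R]_n -> R) (q : 'rV[R]_n) : R :=
  sup [set dot p q - F p | p in setT].

(** As [M] is arbitrary, this is superlinear growth. *)
Definition coercive (R : realType) n (F : 'rV[R]_n -> R) : Prop :=
  forall M : R, exists2 r, 0 < r & forall p, r <= enorm p -> M * enorm p <= F p.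

Lemma continuous_at_subr (R : realType) (V : normedModType R) (f g : V -> R) (z : V) :
  {for z, continuous f} -> {for z, continuous g} ->
  {for z, continuous (fun x => f x - g x)}.
Proof. by move=> cf cg; apply: cvgB; [exact: cf | exact: cg]. Qed.

Lemma dotl_continuous (R : realType) n (q : 'rV[R]_n.+1) :
  continuous (fun p => dot p q).
Proof.
move=> z; apply: (@lipschitz_continuous_at _ _ _ _ _ (n.+1%:R * `|q|)) => h.
by rewrite dotDl addrC addKr mulrAC normr_dot_le.
Qed.

(** Outside a large ball superlinearity pushes [dot p q - F p] below its value [- F 0] at the
    origin, so the maximum over the compact ball is global. *)
Lemma dot_maximizer_exists (R : realType) n (F : 'rV[R]_n.+1 -> R) q :
  continuous F -> coercive F -> exists p, dot_maximizer F q p.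
Proof.
move=> cF coF; pose M := n.+1%:R * `|q|.
have [r r0 rF] := coF (M + 1).
pose A : set 'rV[R]_n.+1 := [set y | `|y| <= Num.max r `|F 0|].
have A0 : A 0 by rewrite /A /= normr0 le_max (ltW r0).
have cg : {within A, continuous (fun p => dot p q - F p)}.
  apply: continuous_in_subspaceT => p _.
  apply: (@continuous_at_subr _ _ (fun p => dot p q) F); last exact: cF.
  exact: dotl_continuous.
have [p Ap pmax] := compact_EVT_max (ex_intro _ 0 A0) (@compact_normr_ball R n _) cg.
exists p => p'; have [Ap'|Ap'] := boolP (`|p'| <= Num.max r `|F 0|).
  exact/pmax/mem_set.
apply: le_trans (pmax 0 (mem_set A0)); rewrite dot0l sub0r.
move: Ap'; rewrite -ltNge gt_max => /andP[rp Fp].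
have pe := normr_le_enorm p'.
have := rF p' (le_trans (ltW rp) pe).
have : dot p' q <= M * enorm p'.
  apply: le_trans (ler_norm _) (le_trans (normr_dot_le _ _) _).
  by rewrite /M mulrAC ler_wpM2l ?mulr_ge0.
by have := ler_norm (F 0); rewrite mulrDl mul1r; lra.
Qed.

Lemma conjugate_max (R : realType) n (F : 'rV[R]_n.+1 -> R) q p :
  dot_maximizer F q p -> conjugate F q = dot p q - F p.
Proof.
move=> pmax; apply/eqP; rewrite eq_le; apply/andP; split.
  by apply: ge_sup => [|_ [p' _ <-]//]; exists (dot p q - F p), p.
apply: ub_le_sup; last by exists p.
by exists (dot p q - F p) => _ [p' _ <-].
Qed.

Lemma fenchel_young (R : realType) n (F : 'rV[R]_n.+1 -> R) q p :
  continuous F -> coercive F -> dot p q - F p <= conjugate F q.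
Proof.
move=> cF coF; have [p' p'P] := dot_maximizer_exists q cF coF.
by rewrite (conjugate_max p'P).
Qed.

(** If the excess at [P] were not positive, strict convexity would make the midpoint of [P] and [p]
    beat the maximizer [p]. *)
Lemma strictly_convex_excess_gt0 (R : realType) n (F : 'rV[R]_n.+1 -> R) v p P :
  strictly_convex F -> dot_maximizer F v p -> P != p ->
  0 < F P - F p - dot (P - p) v.
Proof.
move=> sF pmax Pp; have half : 0 < (2^-1 : R) < 1 by apply/andP; split; lra.
have := sF _ _ _ Pp half; have := pmax (2^-1 *: P + (1 - 2^-1) *: p).
by rewrite !(dotDl, dotNl, dotZl); lra.
Qed.

(** The excess has a positive minimum on the sphere of radius [r] around [p], by compactness;
    convexity along rays makes it grow at least linearly beyond. *)
Lemma strictly_convex_excess_growth (R : realType) n (F : 'rV[R]_n.+1 -> R) v p (r : R) :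
  continuous F -> strictly_convex F -> dot_maximizer F v p -> 0 < r ->
  exists2 k, 0 < k & forall P, r <= `|P - p| ->
    k * `|P - p| <= F P - F p - dot (P - p) v.
Proof.
move=> cF sF pmax r0; pose D Y := F (p + Y) - F p - dot Y v.
pose A : set 'rV[R]_n.+1 := [set Y | `|Y| = r].
have A0 : A !=set0.
  (* A nonzero vector exists because the dimension is positive; rescaled, it shows that the sphere
     is nonempty. *)
  pose c : 'rV[R]_n.+1 := const_mx 1.
  have c0 : `|c| != 0.
    rewrite normr_eq0; apply/eqP => /rowP /(_ ord0); rewrite !mxE => /eqP.
    by rewrite oner_eq0.
  by exists ((r / `|c|) *: c); rewrite /A /= normrZ normf_div normr_id divfK // gtr0_norm.
have cA : compact A.
  apply: (@subclosed_compact _ _ [set y | `|y| <= r]).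
  - apply: (@preimage_closed _ _ (fun y : 'rV[R]_n.+1 => `|y|) [set x | x = r]).
      by move=> y _; exact: norm_continuous.
    exact: closed_eq.
  - exact: compact_normr_ball.
  - by move=> y /= ->.
have cD : {within A, continuous D}.
  apply: continuous_in_subspaceT => Y _; rewrite /D.
  apply: (@continuous_at_subr _ _ (fun Y => F (p + Y) - F p) (fun Y => dot Y v));
    last exact: dotl_continuous.
  apply: (@continuous_at_subr _ _ (fun Y => F (p + Y)) (cst (F p)));
    last exact: cst_continuous.
  apply: (@continuous_comp _ _ _ (fun y => p + y) F); last exact: cF.
  apply: (@lipschitz_continuous_at _ _ _ _ _ 1) => h.
  by rewrite addrA [_ + h]addrC addrK mul1r.
have [Y /set_mem YA Ymin] := compact_EVT_min A0 cA cD.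
have Dpos Z : Z != 0 -> 0 < D Z.
  move=> Z0; have pZ : p + Z - p = Z by rewrite addrAC subrr add0r.
  have := @strictly_convex_excess_gt0 _ _ _ _ _ (p + Z) sF pmax.
  by rewrite -subr_eq0 pZ; apply.
have Y0 : 0 < D Y by apply: Dpos; rewrite -normr_eq0 YA gt_eqF.
exists (D Y / r) => [|P rP]; first by rewrite divr_gt0.
have P0 : 0 < `|P - p| by apply: lt_le_trans rP.
set t := r / `|P - p|.
have t0 : 0 < t by rewrite divr_gt0.
have tY : D Y <= D (t *: (P - p)).
  by apply/Ymin/mem_set; rewrite /A /= normrZ gtr0_norm // divfK // gt_eqF.
have Dconv : D (t *: (P - p)) <= t * (F P - F p - dot (P - p) v).
  move: rP; rewrite le_eqVlt => /predU1P[rE|rP].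
    by rewrite /t rE divff ?gt_eqF // scale1r mul1r /D subrKC.
  have t1 : t < 1 by rewrite ltr_pdivrMr // mul1r.
  have Pp : P != p by rewrite -subr_eq0 -normr_gt0.
  have := sF P p t Pp; rewrite t0 t1 => /(_ isT).
  have -> : t *: P + (1 - t) *: p = p + t *: (P - p).
    by apply/rowP => k; rewrite !mxE; ring.
  by rewrite /D dotZl; lra.
rewrite mulrAC ler_pdivrMr // -ler_pdivlMr // -mulrA [leRHS]mulrC.
by rewrite -/t; apply: le_trans tY Dconv.
Qed.

(** For a maximizer [P] at [v + h], the middle quantity equals [dot (P - p) h] minus the excess of
    [F] at [P]. If [P] is far from [p], the linear growth of the excess absorbs the first term;
    otherwise that term is at most [e * |h|]. The lower bound is the Fenchel inequality at [p]. *)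
Lemma conjugate_expansion (R : realType) n (F : 'rV[R]_n.+1 -> R) v p (e : R) :
  continuous F -> coercive F -> strictly_convex F -> dot_maximizer F v p -> 0 < e ->
  exists2 d : R, 0 < d & forall h, `|h| < d ->
    0 <= conjugate F (v + h) - conjugate F v - dot p h <= e * `|h|.
Proof.
move=> cF coF sF pmax e0; pose N : R := n.+1%:R.
have N0 : 0 < N by rewrite ltr0n.
have [k k0 kP] := strictly_convex_excess_growth cF sF pmax (divr_gt0 e0 N0).
exists (k / N) => [|h]; first by rewrite divr_gt0.
rewrite ltr_pdivlMr // => hk.
have [P Pmax] := dot_maximizer_exists (v + h) cF coF.
have := fenchel_young (v + h) p cF coF.
rewrite (conjugate_max Pmax) (conjugate_max pmax) !dotDr => low.
apply/andP; split; first by lra.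
have Ple : dot (P - p) h <= N * `|P - p| * `|h|.
  exact: le_trans (ler_norm _) (normr_dot_le _ _).
have ex0 : dot P v - F P <= dot p v - F p := pmax P.
suff : dot (P - p) h <= F P - F p - dot (P - p) v + e * `|h|.
  by rewrite !dotBl; lra.
have [Pr|Pr] := leP (e / N) `|P - p|.
  have := kP P Pr; have : N * `|P - p| * `|h| <= k * `|P - p|.
    by rewrite mulrAC ler_wpM2r // mulrC ltW.
  by have := mulr_ge0 (ltW e0) (normr_ge0 h); lra.
have : N * `|P - p| * `|h| <= e * `|h|.
  by rewrite ler_wpM2r // mulrC -ler_pdivlMr // ltW.
by rewrite dotBl in Ple *; rewrite dotBl; lra.
Qed.

(** Maximality gives [dot v h <= l h] for every [h]; replacing [h] by [- h], which homogeneity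
    allows, turns this into equality. So the derivative at a maximizer is [v]. *)
Lemma maximizer_expansion (R : realType) n (F : 'rV[R]_n.+1 -> R) v p
    (l : 'rV[R]_n.+1 -> R) :
  dot_maximizer F v p -> (forall t h, l (t *: h) = t * l h) ->
  (forall e : R, 0 < e -> exists2 d : R, 0 < d & forall h, `|h| < d ->
     `|F (p + h) - F p - l h| <= e * `|h|) ->
  forall e : R, 0 < e -> exists2 d : R, 0 < d & forall h, `|h| < d ->
     `|F (p + h) - F p - dot v h| <= e * `|h|.
Proof.
move=> pmax lZ lP.
have lge h : dot v h <= l h.
  rewrite -subr_le0; apply/ler_addgt0Pr => e e0; rewrite add0r.
  have h1 : 0 < `|h| + 1 by rewrite ltr_wpDl.
  have [d d0 dP] := lP (e / (`|h| + 1)) (divr_gt0 e0 h1).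
  pose t := d / (`|h| + 1).
  have t0 : 0 < t by rewrite divr_gt0.
  have th : `|t *: h| < d.
    rewrite normrZ gtr0_norm // /t mulrAC ltr_pdivrMr // ltr_pM2l //.
    by rewrite ltrDl.
  have := dP _ th; rewrite lZ ler_norml => /andP[_].
  have := pmax (p + t *: h); rewrite dotDl dotZl (dotC h v) normrZ gtr0_norm // => m1 m2.
  have : t * (dot v h - l h) <= t * e.
    have : e / (`|h| + 1) * (t * `|h|) <= t * e.
      rewrite mulrCA ler_wpM2l ?(ltW t0) // mulrAC ler_pdivrMr // ler_wpM2l ?(ltW e0) //.
      by rewrite lerDl.
    by rewrite mulrBr; lra.
  by rewrite ler_pM2l.
have lE h : l h = dot v h.
  apply/eqP; rewrite eq_le lge andbT.
  have := lge (- h); rewrite -scaleN1r lZ dotZr; lra.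
by move=> e e0; have [d d0 dP] := lP e e0; exists d => // h /dP; rewrite lE.
Qed.

(** * Viscosity inequalities *)

(** [G] may depend on the point, which lets it absorb the coupling term evaluated at the
    solution. *)
Definition scalar_subsolution (R : realType) n (G : R * 'rV[R]_n.+1 -> 'rV[R]_n.+1 -> R)
    (f : R * 'rV[R]_n.+1 -> R) : Prop :=
  forall (phi : R * 'rV[R]_n.+1 -> R) (z : R * 'rV[R]_n.+1), 0 < z.1 ->
    C1_on [set z : R * 'rV[R]_n.+1 | 0 < z.1] phi ->
    (\forall z' \near z, f z' - phi z' <= f z - phi z) ->
    derive1 (fun s => phi (s, z.2)) z.1 + G z (grad (fun y => phi (z.1, y)) z.2) <= 0.

Definition scalar_supersolution (R : realType) n (G : R * 'rV[R]_n.+1 -> 'rV[R]_n.+1 -> R)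
    (f : R * 'rV[R]_n.+1 -> R) : Prop :=
  forall (phi : R * 'rV[R]_n.+1 -> R) (z : R * 'rV[R]_n.+1), 0 < z.1 ->
    C1_on [set z : R * 'rV[R]_n.+1 | 0 < z.1] phi ->
    (\forall z' \near z, f z - phi z <= f z' - phi z') ->
    0 <= derive1 (fun s => phi (s, z.2)) z.1 + G z (grad (fun y => phi (z.1, y)) z.2).

Lemma test_function_dt (R : realType) n (A : R) (p : 'rV[R]_n.+1)
    (K M s1 s2 : R) (y1 w : 'rV[R]_n.+1) z :
  derive1 (fun s => test_function A p K M s1 s2 y1 w (s, z.2)) z.1
  = test_dt A K M s1 s2 y1 w z.
Proof.
apply: (@expansion_time _ _ (test_function A p K M s1 s2 y1 w) _ _ _ (test_dx p K s1 y1 w z)).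
by case: z => s y e; exact: test_function_expansion.
Qed.

Lemma test_function_dx (R : realType) n (A : R) (p : 'rV[R]_n.+1)
    (K M s1 s2 : R) (y1 w : 'rV[R]_n.+1) z :
  grad (fun y => test_function A p K M s1 s2 y1 w (z.1, y)) z.2
  = test_dx p K s1 y1 w z.
Proof.
apply: (@expansion_space _ _ (test_function A p K M s1 s2 y1 w) _ _ (test_dt A K M s1 s2 y1 w z)).
by case: z => s y e; exact: test_function_expansion.
Qed.

Lemma moving_box_dist (R : realType) n (s1 s3 rho : R) (y1 w : 'rV[R]_n.+1) z0 z :
  moving_box s1 s3 rho y1 w z ->
  `|z - z0| <= `|(s1, y1) - z0| + (s3 - s1) * (1 + `|w|) + rho.
Proof.
move=> [/andP[s1z zs3] zr].
have -> : z - z0 = ((s1, y1) - z0) + (z.1 - s1, (z.1 - s1) *: w + moving_frame s1 y1 w z).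
  case: z z0 s1z zs3 zr => s y [t x] _ _ _; rewrite /moving_frame /=.
  rewrite -[LHS]/(s - t, y - x).
  rewrite -[RHS]/(s1 - t + (s - s1), y1 - x + ((s - s1) *: w + (y - y1 - (s - s1) *: w))).
  by congr pair; [ring | apply/rowP => k; rewrite !mxE; ring].
apply: le_trans (ler_normD _ _) _; rewrite -addrA lerD2l.
have s0 : 0 <= z.1 - s1 by rewrite subr_ge0.
have rho0 : 0 <= rho by apply: le_trans zr.
have h1 : (z.1 - s1) * `|w| <= (s3 - s1) * `|w| by rewrite ler_wpM2r // lerD2r.
have h2 := mulr_ge0 s0 (normr_ge0 w).
rewrite prod_normE /= ge_max ger0_norm //; apply/andP; split; first by lra.
apply: le_trans (ler_normD _ _) _; rewrite normrZ ger0_norm //; lra.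
Qed.

(** Were the increment above [h * (C + e)], a test function of time slope [b = C + e] would touch
    [f] from above inside a box around the segment. There the paraboloid has gradient [P], its
    motion contributes [- dot P w] to the time derivative, and the lower bound on [G] leaves
    [b <= C]. This bound holds for all [P], so the paraboloid may be as steep as needed. *)
Lemma subsolution_segment (R : realType) n (G : R * 'rV[R]_n.+1 -> 'rV[R]_n.+1 -> R)
    (f : R * 'rV[R]_n.+1 -> R) (z0 : R * 'rV[R]_n.+1) (w : 'rV[R]_n.+1) (d C lip : R) :
  scalar_subsolution G f ->
  (forall z, 0 < z.1 -> {for z, continuous f}) ->
  (forall s y y', 0 < s < 2 * z0.1 -> `|f (s, y) - f (s, y')| <= lip * `|y - y'|) ->
  d <= z0.1 ->
  (forall z P, `|z - z0| < d -> dot P w - C <= G z P) ->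
  forall z h, 0 < h -> `|z - z0| + 2 * h * (1 + `|w|) < d ->
    f (z + (h, h *: w)) - f z <= h * C.
Proof.
move=> fsub fc flip dz0 GC [s1 y1] h h0 hd; set z1 := (s1, y1) in hd *.
have box_dist rho z : moving_box s1 (s1 + 2 * h) rho y1 w z ->
    `|z - z0| <= `|z1 - z0| + 2 * h * (1 + `|w|) + rho.
  by move=> /(@moving_box_dist _ _ _ _ _ _ _ z0); rewrite [s1 + _]addrC addrK.
have pos z : `|z - z0| < d -> 0 < z.1 < 2 * z0.1.
  rewrite prod_normE /= gt_max => /andP[+ _] /=; rewrite ltr_norml => /andP[].
  by move=> *; apply/andP; split; lra.
pose rho := (d - (`|z1 - z0| + 2 * h * (1 + `|w|))) / 2.
have rho0 : 0 < rho by rewrite divr_gt0 // subr_gt0.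
have near_z0 z : moving_box s1 (s1 + 2 * h) rho y1 w z -> `|z - z0| < d.
  by move=> /box_dist; rewrite /rho; lra.
apply/ler_addgt0Pr => e0 e0_gt0.
have e_gt0 : 0 < e0 / h by rewrite divr_gt0.
set e := e0 / h in e_gt0; have -> : e0 = h * e by rewrite /e mulrC divfK // gt_eqF.
rewrite -mulrDr leNgt; apply/negP => fgt.
set z2 := z1 + (h, h *: w) in fgt.
(* [g] is the excess to be refuted. The box runs up to time [s1 + 2 * h], leaving room for the
   penalty after the end [s1 + h] of the segment. *)
pose b := C + e; pose c := f z2 - b * h; pose g := f z2 - f z1 - b * h.
have g0 : 0 < g by rewrite /g subr_gt0 mulrC.
have s13 : s1 <= s1 + 2 * h by lra.
have cbox z : moving_box s1 (s1 + 2 * h) rho y1 w z -> {for z, continuous f}.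
  by move=> /near_z0 /pos /andP[z0' _]; exact: fc.
have [zS _ zSmax] := moving_box_max s13 (ltW rho0) cbox.
set S := f zS in zSmax.
(* The first summand lets the paraboloid and [g] beat the Lipschitz variation of [f] on the initial
   face; the second brings the values on the lateral face below [c]. *)
pose K := lip ^+ 2 / g + (`|S| + 2 * h * `|b| + `|c| + 1) / rho ^+ 2.
have K2 : 0 < (`|S| + 2 * h * `|b| + `|c| + 1) / rho ^+ 2.
  by rewrite divr_gt0 ?exprn_gt0 // ltr_wpDl // !addr_ge0 // !mulr_ge0 // ltW.
have K1 : 0 <= lip ^+ 2 / g by rewrite divr_ge0 ?sqr_ge0 // ltW.
have K0 : 0 < K by rewrite ltr_wpDl.
have ini z : z.1 = s1 -> `|moving_frame s1 y1 w z| <= rho ->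
    f z - K * dot (moving_frame s1 y1 w z) (moving_frame s1 y1 w z) < c.
  case: z => s y /= ->; set Z := moving_frame _ _ _ _ => zr.
  have ZE : Z = y - y1 by rewrite /Z /moving_frame /= subrr scale0r subr0.
  have z1b : `|(s1, y1) - z0| < d.
    apply: le_lt_trans hd; rewrite lerDl mulr_ge0 ?addr_ge0 //; lra.
  have := flip s1 y y1 (pos _ z1b); rewrite -ZE ler_norml => /andP[_ fl].
  have := ler_wpM2l (ltW K0) (sqr_normr_le_dot Z) => kz.
  have lg : lip ^+ 2 <= K * g.
    rewrite /K mulrDl divfK ?gt_eqF // lerDl mulr_ge0 ?(ltW K2) ?(ltW g0) //.
  have amgm : lip * `|Z| < K * `|Z| ^+ 2 + g.
    have [->|Zn0] := eqVneq `|Z| 0; first by rewrite mulr0 expr0n /= mulr0 add0r.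
    have Zp : 0 < `|Z| by rewrite lt_def Zn0 normr_ge0.
    rewrite -subr_gt0 -(pmulr_rgt0 _ K0).
    (* Completing the square; [K * g >= lip ^+ 2] leaves a positive remainder unless [lip = 0],
       which is treated apart. *)
    have -> : K * (K * `|Z| ^+ 2 + g - lip * `|Z|) =
      (K * `|Z| - lip / 2) ^+ 2 + (K * g - lip ^+ 2) + 3 / 4 * lip ^+ 2 by field.
    have := sqr_ge0 (K * `|Z| - lip / 2); have := sqr_ge0 lip => l2 q2.
    have [l0|l0] := eqVneq lip 0.
      rewrite l0 mul0r subr0 expr0n /= subr0 mulr0 addr0.
      by rewrite addr_gt0 ?exprn_gt0 ?mulr_gt0.
    have l2p : 0 < lip ^+ 2 by rewrite lt_def sqrf_eq0 l0.
    by lra.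
  by move: fl kz amgm; rewrite -/z1 /c /g; lra.
have lat z : s1 <= z.1 <= s1 + 2 * h -> `|moving_frame s1 y1 w z| = rho ->
    f z - b * (z.1 - s1) - K * rho ^+ 2 < c.
  move=> zs zr; have fS : f z <= S by apply: zSmax; split; rewrite ?zr.
  have KE : `|S| + 2 * h * `|b| + `|c| + 1 <= K * rho ^+ 2.
    rewrite /K [leRHS]mulrDl divfK ?gt_eqF ?exprn_gt0 // lerDr mulr_ge0 // ltW //.
    by rewrite exprn_gt0.
  have bz : - (b * (z.1 - s1)) <= 2 * h * `|b|.
    apply: le_trans (ler_norm _) _; rewrite normrN normrM mulrC ler_wpM2r //.
    by move: zs => /andP[? ?]; rewrite ger0_norm; lra.
  have := ler_norm S; have := ler_norm (- c); rewrite normrN; lra.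
have fin : c <= f (s1 + h, y1 + (s1 + h - s1) *: w) - b * (s1 + h - s1).
  have -> : s1 + h - s1 = h by ring.
  by rewrite /c.
have [||M [z [M0 zs zr zmax]]] :=
  interior_max _ _ rho0 (ltW K0) cbox ini lat fin; [lra | lra | ].
have zbox : moving_box s1 (s1 + 2 * h) rho y1 w z.
  by move: zs => /andP[? ?]; split; rewrite ?(ltW zr) // !ltW.
have zd := near_z0 _ zbox; have /andP[zpos _] := pos _ zd.
have := fsub _ z zpos (@test_function_C1 _ _ _ _ _ _ _ _ _ _ _) zmax.
rewrite test_function_dt test_function_dx.
have := GC z (test_dx 0 K s1 y1 w z) zd.
rewrite /test_dt /test_dx add0r dotZl.
have : 0 <= 2 * M * Num.max (z.1 - (s1 + h)) 0.
  by rewrite mulr_ge0 ?mulr_ge0 // le_max lexx orbT.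
by rewrite /b; lra.
Qed.

(* If [f] stayed above its linear part by [e * r] at [z0 - lam * r * (1, v)], the
   paraboloid of height [b0 * r] and width [rho * r] transported along [v] would be a
   strict subsolution below [f] at time [z0.1 - lam * r] and above it at [z0]: its
   gradient has size [2 * b0 / rho], so the transport error is [o(b0)]. *)
Lemma supersolution_backward (R : realType) n
    (G : R * 'rV[R]_n.+1 -> 'rV[R]_n.+1 -> R) (f : R * 'rV[R]_n.+1 -> R)
    (z0 : R * 'rV[R]_n.+1) (v p : 'rV[R]_n.+1) (lip : R) :
  scalar_supersolution G f -> 0 < z0.1 -> 0 <= lip ->
  (forall z, 0 < z.1 -> {for z, continuous f}) ->
  (forall s y y', 0 < s < 2 * z0.1 -> `|f (s, y) - f (s, y')| <= lip * `|y - y'|) ->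
  (forall M e : R, 0 < e -> exists2 d : R, 0 < d & forall z P, `|z - z0| < d ->
     `|P| <= M -> G z P <= G z0 P + e) ->
  (forall e : R, 0 < e -> exists2 d : R, 0 < d & forall h, `|h| < d ->
     `|G z0 (p + h) - G z0 p - dot v h| <= e * `|h|) ->
  (forall e : R, 0 < e -> exists2 d : R, 0 < d & forall h, `|h| < d ->
     - (e * `|h|) <= f (z0 + h) - f z0 + G z0 p * h.1 - dot p h.2) ->
  forall lam e : R, 0 < lam -> 0 < e -> exists2 d : R, 0 < d & forall r, 0 < r < d ->
    f (z0 - (lam * r) *: (1, v)) - f z0 - G z0 p * (lam * r) + dot p ((lam * r) *: v)
      <= e * r.
Proof.
move=> fsup z00 lip0 fc flip Gz Gp low lam e lam0 e0.
(* A Lipschitz constant in space for [f] minus its linear part. Since [Lw * rho = e / 2], an excess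
   [e * r] at the centre of the initial face leaves at least [e * r / 2] on all of it. *)
pose Lw := lip + n.+1%:R * `|p| + 1.
have Lw0 : 0 < Lw by rewrite ltr_wpDl // addr_ge0 // mulr_ge0.
pose rho := e / (2 * Lw).
have rho0 : 0 < rho by rewrite divr_gt0 // mulr_gt0.
have t16 : 0 < rho / (16 * lam) by rewrite divr_gt0 // mulr_gt0.
have [d3 d30 Gp3] := Gp _ t16.
(* The first bound makes the height at most the excess left on the initial face; the second keeps
   the gradient [2 * b0 / rho] of the paraboloid below [d3]. *)
pose b0 := Num.min (e / 2) (d3 * rho / 4).
have b00 : 0 < b0 by rewrite lt_min !divr_gt0 // mulr_gt0.
have b0e : b0 <= e / 2 by rewrite ge_min lexx.
have b0d : b0 <= d3 * rho / 4 by rewrite ge_min lexx orbT.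
pose cz := 3 * lam * (1 + `|v|) + rho.
have cz0 : 0 < cz by rewrite ltr_wpDl // !mulr_ge0 ?addr_ge0 // ltW.
have t4 : 0 < b0 / (4 * cz) by rewrite divr_gt0 // mulr_gt0.
have [d1 d10 low1] := low _ t4.
(* The admissible size of each of two errors: moving [G] from [z0] to the contact point, and
   linearizing [G z0] at [p]. The time slope [b] below is [4 * t], so their sum cannot offset it. *)
pose t := b0 / (8 * lam).
have t0 : 0 < t by rewrite divr_gt0 // mulr_gt0.
have [d2 d20 Gz2] := Gz (`|p| + d3) _ t0.
exists (Num.min z0.1 (Num.min d1 d2) / cz); first by rewrite divr_gt0 // !lt_min z00 d10.
move=> r /andP[r0]; rewrite ltr_pdivlMr // mulrC !lt_min => /and3P[rz rd1 rd2].
rewrite leNgt; apply/negP.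
set g0 := G z0 p.
pose s1 := z0.1 - lam * r; pose y1 := z0.2 - (lam * r) *: v.
have -> : z0 - (lam * r) *: (1, v) = (s1, y1).
  rewrite -[LHS]/(z0.1 - (lam * r) *: 1, y1); congr pair.
  by rewrite /s1 -[_ *: 1]/(_ * _) mulr1.
move=> Wb.
have lr0 : 0 < lam * r by rewrite mulr_gt0.
pose s3 := z0.1 + lam * r.
have rr0 : 0 < rho * r by rewrite mulr_gt0.
pose W z := f z - f z0 + g0 * (z.1 - z0.1) - dot p (z.2 - z0.2).
have box_dist z : moving_box s1 s3 (rho * r) y1 v z -> `|z - z0| <= cz * r.
  move=> /(@moving_box_dist _ _ _ _ _ _ _ z0) /le_trans; apply.
  have -> : s3 - s1 = 2 * lam * r by rewrite /s1 /s3; ring.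
  suff : `|(s1, y1) - z0| <= lam * r * (1 + `|v|) by rewrite /cz; lra.
  have -> : (s1, y1) - z0 = (- (lam * r), - ((lam * r) *: v)).
    rewrite -[LHS]/(s1 - z0.1, y1 - z0.2); congr pair; first by rewrite /s1; ring.
    by rewrite /y1 addrC addKr.
  rewrite prod_normE /= !normrN [`|_ *: v|]normrZ (gtr0_norm lr0) ge_max mulrDr mulr1.
  by rewrite lerDl lerDr mulr_ge0 // ltW.
have pos z : moving_box s1 s3 (rho * r) y1 v z -> 0 < z.1.
  move=> /box_dist; rewrite prod_normE /= ge_max => /andP[+ _].
  by rewrite /= ler_norml => /andP[]; lra.
have cW z : moving_box s1 s3 (rho * r) y1 v z -> {for z, continuous (fun z => - W z)}.
  move=> /pos zpos.
  have -> : (fun z => - W z) =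
      (fun z => f z0 - g0 * (z.1 - z0.1) + dot p (z.2 - z0.2) - f z).
    by apply/funext => x; rewrite /W; ring.
  apply: (@continuous_at_subr _ _ (fun z : R * 'rV[R]_n.+1 =>
    f z0 - g0 * (z.1 - z0.1) + dot p (z.2 - z0.2)) f); last exact: fc.
  apply: (@lipschitz_continuous_at _ _ _ _ _ (`|- g0| + n.+1%:R * `|p|)) => h.
  have -> : f z0 - g0 * ((z + h).1 - z0.1) + dot p ((z + h).2 - z0.2)
    - (f z0 - g0 * (z.1 - z0.1) + dot p (z.2 - z0.2)) = - g0 * h.1 + dot p h.2.
    by rewrite !dotBr /= dotDr; ring.
  exact: normr_affine_part_le.
(* Three heights compete, in units of [b0 * r]: the paraboloid reaches 1 on the lateral face, the
   slope [b] loses 1/2 up to time [z0.1], and the lower bound [low] lets [- W] reach at most 1/4. *)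
pose K := b0 / (rho ^+ 2 * r).
have K0 : 0 < K by rewrite divr_gt0 // mulr_gt0 // exprn_gt0.
have KE : K * (rho * r) ^+ 2 = b0 * r.
  by rewrite /K; field; rewrite !gt_eqF.
pose b := b0 / (2 * lam).
have bE : b * (lam * r) = b0 * r / 2 by rewrite /b; field; rewrite gt_eqF.
pose c := - (b0 * r / 2).
have b0r : 0 < b0 * r by rewrite mulr_gt0.
have ini z : z.1 = s1 -> `|moving_frame s1 y1 v z| <= rho * r ->
    - W z - K * dot (moving_frame s1 y1 v z) (moving_frame s1 y1 v z) < c.
  case: z => s y /= ->; set Z := moving_frame _ _ _ _ => zr.
  have ZE : Z = y - y1 by rewrite /Z /moving_frame /= subrr scale0r subr0.
  have s1b : 0 < s1 < 2 * z0.1.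
    have : moving_box s1 s3 (rho * r) y1 v (s1, y1).
      split; first by apply/andP; split; rewrite /= /s1 /s3; lra.
      by rewrite /moving_frame /= !subrr scale0r subrr normr0 ltW.
    by move=> /pos /= ->; rewrite /s1; lra.
  have := flip s1 y y1 s1b; rewrite -ZE ler_norml => /andP[fl _].
  have pZ : dot p Z <= n.+1%:R * `|p| * `|Z|.
    exact: le_trans (ler_norm _) (normr_dot_le _ _).
  have WE : W (s1, y) = W (s1, y1) + (f (s1, y) - f (s1, y1)) - dot p Z.
    by rewrite /W /= ZE !dotBr; ring.
  have WbE : W (s1, y1) > e * r.
    by move: Wb; rewrite /W /= /s1 /y1 !dotBr; lra.
  have LZ : Lw * `|Z| <= e * r / 2.
    have -> : e * r / 2 = Lw * (rho * r) by rewrite /rho; field; rewrite gt_eqF.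
    by rewrite ler_wpM2l // ltW.
  have b0er : b0 * r <= e / 2 * r by rewrite ler_wpM2r // ltW.
  have KZ : 0 <= K * dot Z Z by rewrite mulr_ge0 ?dot_ge0 // ltW.
  by move: LZ; rewrite WE /c /Lw !mulrDl mul1r; have := normr_ge0 Z; lra.
have lat z : s1 <= z.1 <= s3 -> `|moving_frame s1 y1 v z| = rho * r ->
    - W z - b * (z.1 - s1) - K * (rho * r) ^+ 2 < c.
  move=> zs zr.
  have zd : `|z - z0| <= cz * r by apply: box_dist; split; rewrite ?zr.
  have := low1 (z - z0) (le_lt_trans zd rd1); rewrite subrKC -/g0 => lowW.
  have : b0 / (4 * cz) * `|z - z0| <= b0 * r / 4.
    have -> : b0 * r / 4 = b0 / (4 * cz) * (cz * r) by field; rewrite gt_eqF.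
    by rewrite ler_wpM2l // ltW.
  have : 0 <= b * (z.1 - s1).
    by rewrite mulr_ge0 ?subr_ge0; [ | rewrite ltW // divr_gt0 // mulr_gt0 | case/andP: zs].
  by rewrite KE /c; move: lowW; rewrite -/(W z); lra.
have fin : c <= - W (z0.1, y1 + (z0.1 - s1) *: v) - b * (z0.1 - s1).
  have -> : z0.1 - s1 = lam * r by rewrite /s1; ring.
  rewrite /y1 subrK -surjective_pairing /W !subrr dot0r mulr0 bE /c; lra.
have [||M [z [M0 zs zr zmax]]] :=
  interior_max _ _ rr0 (ltW K0) cW ini lat fin; [rewrite /s1; lra | rewrite /s3; lra | ].
have zbox : moving_box s1 s3 (rho * r) y1 v z.
  by move: zs => /andP[? ?]; split; rewrite ?(ltW zr) // !ltW.
have zd := box_dist _ zbox.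
(* Changing sign and adding back the linear part turns the interior maximum of [- W] minus its test
   function into a minimum of [f] minus another one, as the supersolution property requires. *)
have tE x : f x - test_function (- g0 - b) p (- K) (- M) s1 z0.1 y1 v x
    = f z0 + g0 * z0.1 - dot p z0.2 - (- W x - test_function b 0 K M s1 z0.1 y1 v x).
  by rewrite /W /test_function dot0l !dotBr; ring.
have := fsup _ z (pos _ zbox) (@test_function_C1 _ _ (- g0 - b) p (- K) (- M) s1 z0.1 y1 v _).
rewrite test_function_dt test_function_dx => /(_ _)/wrap[].
  by apply: filterS zmax => x; rewrite !tE lerD2l lerN2.
rewrite /test_dt /test_dx; set Z := moving_frame _ _ _ _ in zr *.
set h := (2 * - K) *: Z.
have hn : `|h| <= 2 * b0 / rho.
  have -> : 2 * b0 / rho = 2 * K * (rho * r) by rewrite /K; field; rewrite !gt_eqF.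
  have K2 : 0 < 2 * K by rewrite mulr_gt0.
  by rewrite normrZ mulrN normrN (gtr0_norm K2) ler_wpM2l ?(ltW K2) ?(ltW zr).
have hd3 : `|h| < d3.
  apply: le_lt_trans hn _; rewrite ltr_pdivrMr //.
  have : 0 < d3 * rho by rewrite mulr_gt0.
  by lra.
have := Gz2 z (p + h) (le_lt_trans zd rd2).
have ph : `|p + h| <= `|p| + d3.
  by apply: le_trans (ler_normD _ _) _; rewrite lerD2l ltW.
move=> /(_ ph).
have := Gp3 h hd3; rewrite -/g0 ler_norml => /andP[_].
have : rho / (16 * lam) * `|h| <= t.
  have -> : t = rho / (16 * lam) * (2 * b0 / rho).
    by rewrite /t; field; rewrite !gt_eqF.
  by rewrite ler_wpM2l // ltW.
have -> : dot v h = - (2 * K * dot Z v) by rewrite /h dotZr dotC; ring.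
have : 0 <= M * Num.max (z.1 - z0.1) 0.
  by rewrite mulr_ge0 // le_max lexx orbT.
have -> : b = 4 * t by rewrite /b /t; field; rewrite gt_eqF.
lra.
Qed.

(** * Touching by linear forms *)

(* The cost of a displacement [d] in time [k] with velocity close to [v] is that of
   the linear form of time slope [- g] and space slope [p], up to small errors. *)
Definition segment_bound (R : realType) n (f : R * 'rV[R]_n.+1 -> R)
    (z0 : R * 'rV[R]_n.+1) (v p : 'rV[R]_n.+1) (g : R) : Prop :=
  forall e : R, 0 < e -> exists2 d3 : R, 0 < d3 & forall e2 : R, 0 < e2 ->
  exists2 d : R, 0 < d & forall z k x, `|z - z0| < d -> 0 < k < d ->
    `|x - k *: v| < k * d3 ->
    f (z + (k, x)) - f z <= dot p x - k * g + e * `|x - k *: v| + k * e2.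

(** The segment has velocity [w = x / k] and costs at most [k * (conjugate (G z0) w + e2)], where
    [e2] pays for moving the base point. Expanding the conjugate at [v], with value
    [dot p v - G z0 p] and gradient [p], gives the linear form; the threshold on velocities depends
    on [e] only. *)
Lemma subsolution_segment_bound (R : realType) n
    (G : R * 'rV[R]_n.+1 -> 'rV[R]_n.+1 -> R) (f : R * 'rV[R]_n.+1 -> R)
    (z0 : R * 'rV[R]_n.+1) (v p : 'rV[R]_n.+1) (lip : R) :
  scalar_subsolution G f -> 0 < z0.1 ->
  (forall z, 0 < z.1 -> {for z, continuous f}) ->
  (forall s y y', 0 < s < 2 * z0.1 -> `|f (s, y) - f (s, y')| <= lip * `|y - y'|) ->
  (forall M e : R, 0 < e -> exists2 d : R, 0 < d & forall z P w, `|z - z0| < d ->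
     `|w| <= M -> dot P w - conjugate (G z0) w - e <= G z P) ->
  continuous (G z0) -> coercive (G z0) -> strictly_convex (G z0) ->
  dot_maximizer (G z0) v p ->
  segment_bound f z0 v p (G z0 p).
Proof.
move=> fsub z00 fc flip GC Gc Gco Gs pmax e e0.
have [d d0 dP] := conjugate_expansion Gc Gco Gs pmax e0.
exists (Num.min 1 d) => [|e2 e20]; first by rewrite lt_min ltr01.
have [dG dG0 dGP] := GC (`|v| + 1) e2 e20.
pose D := Num.min dG z0.1.
have D0 : 0 < D by rewrite lt_min dG0.
have v0 := normr_ge0 v.
have v5 : 0 < 5 + 2 * `|v| by lra.
(* From [|w| <= |v| + 1], the quantity to keep below [D] is at most [|z - z0| + 2 * k * (2 + |v|)],
   whose coefficients sum to [5 + 2 * |v|]. *)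
exists (D / (5 + 2 * `|v|)) => [|z k x]; first by rewrite divr_gt0.
rewrite !ltr_pdivlMr // => zd /andP[k0 kd] xd.
pose w := k^-1 *: x.
have xE : x = k *: w by rewrite /w scalerA divff ?gt_eqF // scale1r.
have wvE : `|x - k *: v| = k * `|w - v| by rewrite xE -scalerBr normrZ gtr0_norm.
move: xd; rewrite wvE ltr_pM2l // lt_min => /andP[wv1 wvd].
have wM : `|w| <= `|v| + 1.
  by rewrite -[w](subrKC v); apply: le_trans (ler_normD _ _) _; rewrite lerD2l ltW.
have GD z' P : `|z' - z0| < D -> dot P w - (conjugate (G z0) w + e2) <= G z' P.
  by rewrite lt_min opprD addrA => /andP[zG _]; exact: dGP.
have Dz0 : D <= z0.1 by rewrite ge_min lexx orbT.
have kw : k * `|w| <= k * (`|v| + 1) by rewrite ler_wpM2l // ltW.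
have zk : `|z - z0| + 2 * k * (1 + `|w|) < D.
  apply: (@le_lt_trans _ _ (`|z - z0| + 2 * k * (2 + `|v|))); first by lra.
  have : (5 + 2 * `|v|) * (`|z - z0| + 2 * k * (2 + `|v|)) < (5 + 2 * `|v|) * D.
    have -> : (5 + 2 * `|v|) * D = D + (4 + 2 * `|v|) * D by ring.
    have -> : (5 + 2 * `|v|) * (`|z - z0| + 2 * k * (2 + `|v|))
      = `|z - z0| * (5 + 2 * `|v|) + (4 + 2 * `|v|) * (k * (5 + 2 * `|v|)) by ring.
    rewrite ltrD // ltr_pM2l //; lra.
  by rewrite ltr_pM2l.
have := subsolution_segment fsub fc flip Dz0 GD k0 zk.
rewrite -xE => /le_trans; apply.
have /andP[_] := dP _ wvd; rewrite subrKC (conjugate_max pmax) dotBr => conj.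
have := ler_wpM2l (ltW k0) conj; have -> : dot p x = k * dot p w by rewrite {1}xE dotZr.
have -> : e * (k * `|w - v|) = k * (e * `|w - v|) by ring.
by rewrite !mulrBr !mulrDr; lra.
Qed.

(** The segment from [z0 + h] to the point of the curve at [s = La * |h|] bounds [f] at that point
    from above, and [touch] bounds it from below; the difference is the claim. *)
Lemma lower_touching (R : realType) n (f : R * 'rV[R]_n.+1 -> R)
    (z0 : R * 'rV[R]_n.+1) (v p : 'rV[R]_n.+1) (g : R) (xi : R -> 'rV[R]_n.+1) :
  segment_bound f z0 v p g ->
  (forall e : R, 0 < e -> exists2 d : R, 0 < d & forall s, 0 < s < d ->
     `|xi s - z0.2 - s *: v| <= e * s) ->
  (forall e : R, 0 < e -> exists2 d : R, 0 < d & forall s, 0 < s < d ->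
     dot p (xi s - z0.2) - s * (g + e) <= f (z0.1 + s, xi s) - f z0) ->
  forall e : R, 0 < e -> exists2 d : R, 0 < d & forall h, `|h| < d ->
     - (e * `|h|) <= f (z0 + h) - f z0 + g * h.1 - dot p h.2.
Proof.
move=> seg xid touch e e0.
have v0 := normr_ge0 v; set c := 2 + `|v|.
have c0 : 0 < c by rewrite /c; lra.
have eS0 : 0 < e / (2 * c) by rewrite divr_gt0 // mulr_gt0.
have [d3 d30 seg3] := seg _ eS0.
(* The segment lasts at least [(La - 1) * r] and strays from direction [v] by at most [c * r]; as
   [(La - 1) * d3 = d3 + c], its velocity is within [d3] of [v]. *)
pose La := 2 + c / d3.
have La0 : 2 < La by rewrite ltrDl divr_gt0.
have e20 : 0 < e / (2 * (2 * La + 1)) by rewrite divr_gt0 // mulr_gt0 //; lra.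
set e2 := e / _ in e20.
have [dS dS0 segS] := seg3 _ e20.
(* With this tolerance the curve at [s = La * r] strays from the line of velocity [v] by at most
   [r]. *)
have e40 : 0 < La^-1 by rewrite invr_gt0; lra.
have [d4 d40 xi4] := xid _ e40.
have [d5 d50 touch5] := touch _ e20.
pose D := Num.min dS (Num.min d4 d5).
have D0 : 0 < D by rewrite !lt_min dS0 d40.
exists (D / (La + 1)) => [|h]; first by rewrite divr_gt0 //; lra.
rewrite ltr_pdivlMr ?lt_min; last by lra.
move=> /and3P[hS h4 h5].
have [->|hn0] := eqVneq h 0.
  by rewrite normr0 addr0 subrr /= dot0r !mulr0 oppr0; lra.
have r0 : 0 < `|h| by rewrite normr_gt0.
set r := `|h| in hS h4 h5 r0 *.
pose s := La * r.
have Lr : 2 * r < La * r by rewrite ltr_pM2r.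
have s0 : 0 < s by rewrite /s; lra.
have h1 : `|h.1| <= r by rewrite /r prod_normE le_max lexx.
have := ler_norm h.1; have := ler_norm (- h.1); rewrite normrN => hl hu.
pose k := s - h.1; pose x := xi s - z0.2 - h.2.
have zE : z0 + h + (k, x) = (z0.1 + s, xi s).
  rewrite -[LHS]/(z0.1 + h.1 + k, z0.2 + h.2 + x); congr pair; first by rewrite /k; ring.
  by rewrite /x; apply/rowP => i; rewrite !mxE; ring.
have xv : `|x - k *: v| <= c * r.
  have -> : x - k *: v = (xi s - z0.2 - s *: v) - (h.2 - h.1 *: v).
    by rewrite /x /k; apply/rowP => i; rewrite !mxE; ring.
  apply: le_trans (ler_normB _ _) _.
  have sd4 : 0 < s < d4 by rewrite s0 /s; lra.
  have := xi4 s sd4; have -> : La^-1 * s = r by rewrite /s mulKf // gt_eqF; lra.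
  by have := moving_frame_lip v h; rewrite -/r /c; lra.
have kd : 0 < k < dS by rewrite /k /s; apply/andP; split; lra.
have zd : `|z0 + h - z0| < dS.
  by rewrite addrC addKr -/r; lra.
have xd3 : `|x - k *: v| < k * d3.
  apply: (le_lt_trans xv); have : (La * r - r) * d3 <= k * d3.
    by rewrite ler_pM2r // /k /s; lra.
  have -> : (La * r - r) * d3 = d3 * r + c * r by rewrite /La; field; rewrite gt_eqF.
  have : 0 < d3 * r by rewrite mulr_gt0.
  by lra.
have := segS _ _ _ zd kd xd3; rewrite zE.
have sd5 : 0 < s < d5 by rewrite s0 /s; lra.
have := touch5 s sd5.
have xvS : e / (2 * c) * `|x - k *: v| <= e * r / 2.
  have -> : e * r / 2 = e / (2 * c) * (c * r) by field; rewrite gt_eqF.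
  by rewrite ler_wpM2l // ltW.
have ks : (s + k) * e2 <= e * r / 2.
  have -> : e * r / 2 = (2 * La + 1) * r * e2.
    by rewrite /e2; field; apply: lt0r_neq0; lra.
  by rewrite ler_wpM2r ?(ltW e20) // /k /s; lra.
have -> : dot p x = dot p (xi s - z0.2) - dot p h.2 by rewrite /x [LHS]dotBr.
have -> : k * g = s * g - g * h.1 by rewrite /k; ring.
lra.
Qed.

(** Here the segment ends at [z0 + h] and starts on the line through [z0], where [f] is bounded from
    above. The error [e] is split in three: velocity, base point, and starting value. *)
Lemma upper_touching (R : realType) n (f : R * 'rV[R]_n.+1 -> R)
    (z0 : R * 'rV[R]_n.+1) (v p : 'rV[R]_n.+1) (g : R) :
  segment_bound f z0 v p g ->
  (forall lam e : R, 0 < lam -> 0 < e -> exists2 d : R, 0 < d & forall r, 0 < r < d ->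
    f (z0 - (lam * r) *: (1, v)) - f z0 - g * (lam * r) + dot p ((lam * r) *: v)
      <= e * r) ->
  forall e : R, 0 < e -> exists2 d : R, 0 < d & forall h, `|h| < d ->
     f (z0 + h) - f z0 + g * h.1 - dot p h.2 <= e * `|h|.
Proof.
move=> seg back e e0.
have v0 := normr_ge0 v; set c := 1 + `|v|.
have c0 : 0 < c by rewrite /c; lra.
have eS0 : 0 < e / (3 * c) by rewrite divr_gt0 // mulr_gt0.
have [d3 d30 seg3] := seg _ eS0.
pose La := 2 + c / d3.
have La0 : 2 < La by rewrite ltrDl divr_gt0.
have La0' : 0 < La by lra.
have e20 : 0 < e / (3 * (La + 1)) by rewrite divr_gt0 // mulr_gt0 //; lra.
set e2 := e / _ in e20.
have [dS dS0 segS] := seg3 _ e20.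
have e30 : 0 < e / 3 by lra.
have [d4 d40 back4] := back La (e / 3) La0' e30.
pose D := Num.min (dS / (La * c + 1)) d4.
have Lc : 0 < La * c by rewrite mulr_gt0.
have D0 : 0 < D by rewrite !lt_min d40 andbT divr_gt0 //; lra.
exists D => // h; rewrite lt_min ltr_pdivlMr; last by lra.
move=> /andP[hS h4].
have [->|hn0] := eqVneq h 0.
  by rewrite normr0 addr0 subrr /= dot0r !mulr0; lra.
have r0 : 0 < `|h| by rewrite normr_gt0.
set r := `|h| in hS h4 r0 *.
have Lr : 2 * r < La * r by rewrite ltr_pM2r.
have Lrc : La * r <= La * r * c by rewrite ler_peMr /c; lra.
have h1 : `|h.1| <= r by rewrite /r prod_normE le_max lexx.
have := ler_norm h.1; have := ler_norm (- h.1); rewrite normrN => hl hu.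
pose k := h.1 + La * r; pose x := h.2 + (La * r) *: v.
set zb := z0 - (La * r) *: (1, v).
have zE : zb + (k, x) = z0 + h.
  rewrite -[LHS]/(z0.1 - (La * r) * 1 + k, z0.2 - (La * r) *: v + x).
  rewrite -[RHS]/(z0.1 + h.1, z0.2 + h.2); congr pair; first by rewrite /k; ring.
  by rewrite /x; apply/rowP => i; rewrite !mxE; ring.
have xE : x - k *: v = h.2 - h.1 *: v.
  by rewrite /x /k; apply/rowP => i; rewrite !mxE; ring.
have xv : `|x - k *: v| <= c * r by rewrite xE; exact: moving_frame_lip.
have kd : 0 < k < dS by rewrite /k; apply/andP; split; lra.
have zd : `|zb - z0| < dS.
  rewrite /zb addrAC subrr sub0r normrN normrZ (@gtr0_norm _ (La * r)) ?mulr_gt0 //.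
  have : `|(1, v) : R * 'rV[R]_n.+1| <= c.
    by rewrite prod_normE /= normr1 ge_max /c lerDl lerDr ler01 normr_ge0.
  move=> /(ler_wpM2l (ltW (mulr_gt0 La0' r0))); lra.
have xd3 : `|x - k *: v| < k * d3.
  apply: (le_lt_trans xv); have : (La * r - r) * d3 <= k * d3.
    by rewrite ler_pM2r // /k; lra.
  have -> : (La * r - r) * d3 = d3 * r + c * r by rewrite /La; field; rewrite gt_eqF.
  have : 0 < d3 * r by rewrite mulr_gt0.
  by lra.
have := segS _ _ _ zd kd xd3; rewrite zE.
have rd4 : 0 < r < d4 by rewrite r0.
have := back4 r rd4; rewrite -/zb.
have xvS : e / (3 * c) * `|x - k *: v| <= e * r / 3.
  have -> : e * r / 3 = e / (3 * c) * (c * r) by field; rewrite gt_eqF.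
  by rewrite ler_wpM2l // ltW.
have ks : k * e2 <= e * r / 3.
  have -> : e * r / 3 = (La + 1) * r * e2.
    by rewrite /e2; field; apply: lt0r_neq0; lra.
  by rewrite ler_wpM2r ?(ltW e20) // /k; lra.
have -> : dot p x = dot p h.2 + dot p ((La * r) *: v) by rewrite /x dotDr.
have -> : k * g = g * h.1 + g * (La * r) by rewrite /k; ring.
lra.
Qed.

(** * Calibrated curves *)

(* The integral of a nonnegative function is a supremum over simple functions below
   it, so measurability plays no role in monotonicity. *)
Lemma ge0_le_integral_nonmeasurable d (T : measurableType d) (R : realType)
    (mu : {measure set T -> \bar R}) (D : set T) (f g : T -> \bar R) :
  (forall x, D x -> 0 <= f x)%E -> (forall x, D x -> f x <= g x)%E ->
  (\int[mu]_(x in D) f x <= \int[mu]_(x in D) g x)%E.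
Proof.
move=> f0 fg.
have g0 x : D x -> (0 <= g x)%E by move=> Dx; exact: le_trans (f0 _ Dx) (fg _ Dx).
rewrite !ge0_integralE //; apply: le_ereal_sup => _ [h /= hf <-].
exists h => // x; apply: le_trans (hf x) _; rewrite /patch.
by case: ifPn => // /set_mem; exact: fg.
Qed.

Lemma le_integral_nonmeasurable d (T : measurableType d) (R : realType)
    (mu : {measure set T -> \bar R}) (D : set T) (f g : T -> \bar R) :
  (forall x, D x -> f x <= g x)%E ->
  (\int[mu]_(x in D) f x <= \int[mu]_(x in D) g x)%E.
Proof.
move=> fg; rewrite integralE [leRHS]integralE leeB //.
  apply: ge0_le_integral_nonmeasurable => x Dx; first exact: funepos_ge0.
  by apply: (@funepos_le _ _ D); rewrite ?inE // => y /set_mem; exact: fg.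
apply: ge0_le_integral_nonmeasurable => x Dx; first exact: funeneg_ge0.
by apply: (@funeneg_le _ _ D); rewrite ?inE // => y /set_mem; exact: fg.
Qed.

Lemma derivable_expansion (R : realType) (V : normedModType R) (f : R -> V) (s : R) :
  derivable f s 1 -> forall e : R, 0 < e -> exists2 d : R, 0 < d &
    forall h, `|h| < d -> `|f (s + h) - f s - h *: derive1 f s| <= e * `|h|.
Proof.
move=> /derivable1_diffP df e e0; have [d d0 dP] := diff_expansion df e0.
by exists d => // h /dP; rewrite diff1E.
Qed.

(** [l] is compared with a continuous minorant that is affine in the velocity, hence the derivative
    of an explicit function of the curve. *)
Lemma action_lower_bound (R : realType) n (a b : R) (ga : R -> 'rV[R]_n.+1)
    (p : 'rV[R]_n.+1) (c X : R) (l : R -> R) : a < b ->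
  (forall s, a <= s <= b -> derivable ga s 1 /\ {for s, continuous (derive1 ga)}) ->
  (forall s, a <= s <= b -> dot p (- derive1 ga s) - c <= l s) ->
  X%:E = (\int[lebesgue_measure]_(s in `[a, b]) (l s)%:E)%E ->
  dot p (ga a - ga b) - (b - a) * c <= X.
Proof.
move=> ab dga gl XE.
pose g s : R := dot p (- derive1 ga s) - c.
pose F s : R := - dot p (ga s) - s * c.
have dF s : a <= s <= b -> is_derive s 1 F (g s).
  move=> /dga[ds _]; apply: is_derive_expansion => e e0.
  have c0 : 0 < n.+1%:R * `|p| + 1 :> R by rewrite ltr_wpDl ?mulr_ge0.
  have [d d0 dP] := derivable_expansion ds (divr_gt0 e0 c0).
  exists d => // h /dP hd.
  have -> : F (s + h) - F s - g s * h
      = - dot p (ga (s + h) - ga s - h *: derive1 ga s).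
    by rewrite /F /g !dotBr dotZr dotNr; ring.
  rewrite normrN; apply: le_trans (normr_dot_le _ _) _.
  apply: (le_trans (ler_wpM2l _ hd)); first by rewrite mulr_ge0.
  rewrite [leLHS]mulrA ler_wpM2r // [leLHS]mulrA ler_pdivrMr // [leLHS]mulrC.
  by rewrite ler_wpM2l ?(ltW e0) // lerDl.
have cF s : a <= s <= b -> F x @[x --> s] --> F s.
  by move=> /dF sF; apply: differentiable_continuous; apply/derivable1_diffP.
have cg : {within `[a, b], continuous g}.
  apply: continuous_in_subspaceT => s /set_mem /=; rewrite in_itv /= => /dga[_ cs].
  apply: (@continuous_at_subr _ _ (fun s => dot p (- derive1 ga s)) (cst c));
    last exact: cst_continuous.
  apply: (@continuous_comp _ _ _ (derive1 ga) (fun v => dot p (- v))) => //.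
  apply: (@lipschitz_continuous_at _ _ _ _ _ (n.+1%:R * `|p|)) => h.
  by rewrite -dotBr opprD opprK addrAC addNr add0r dotNr normrN normr_dot_le.
have oc s : s \in `]a, b[ -> a <= s <= b by rewrite in_itv => /andP[? ?]; rewrite !ltW.
have LR : derivable_oo_LRcontinuous F a b.
  split=> [s /oc /dF[] //||].
    by apply: cvg_at_right_filter; apply: cF; rewrite lexx ltW.
  by apply: cvg_at_left_filter; apply: cF; rewrite lexx ltW.
have F'g : {in `]a, b[, derive1 F =1 g}.
  by move=> s /oc /dF[_ sF]; rewrite derive1E.
have intg := continuous_FTC2 ab cg LR F'g.
have : ((F b)%:E - (F a)%:E <= X%:E)%E.
  rewrite -intg XE; apply: le_integral_nonmeasurable => s /=.
  by rewrite in_itv lee_fin; exact: gl.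
by rewrite -EFinB lee_fin /F dotBr; lra.
Qed.

(** Let [b] tend to 0. The increments are available only for [b > 0] because the curve may lack a
    two-sided derivative at a jump; continuity of [f] recovers the endpoint. *)
Lemma touch_of_increments (R : realType) n (f : R * 'rV[R]_n.+1 -> R)
    (z0 : R * 'rV[R]_n.+1) (v p : 'rV[R]_n.+1) (g : R) (xi : R -> 'rV[R]_n.+1) :
  {for z0, continuous f} ->
  (forall e : R, 0 < e -> exists2 d : R, 0 < d & forall s, 0 < s < d ->
     `|xi s - z0.2 - s *: v| <= e * s) ->
  (forall e : R, 0 < e -> exists2 d : R, 0 < d & forall a b, 0 < b < a -> a < d ->
     dot p (xi a - xi b) - (a - b) * (g + e) <= f (z0.1 + a, xi a) - f (z0.1 + b, xi b)) ->
  forall e : R, 0 < e -> exists2 d : R, 0 < d & forall s, 0 < s < d ->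
     dot p (xi s - z0.2) - s * (g + e) <= f (z0.1 + s, xi s) - f z0.
Proof.
move=> /continuous_dist fc xid inc e e0; have [d d0 dP] := inc e e0.
exists d => // s /andP[s0 sd]; apply/ler_addgt0Pr => k k0.
have [d1 d10 xi1] := xid 1 ltr01.
have k3 : 0 < k / 3 by rewrite divr_gt0.
have [d2 d20 f2] := fc _ k3.
(* [b * Q] bounds at once the displacement of the curve and the errors in the slope and in the
   linear form. *)
pose Q := 1 + `|v| + `|g + e| + n.+1%:R * `|p| * (1 + `|v|).
have v0 := normr_ge0 v; have g0 := normr_ge0 (g + e).
have p0 : 0 <= n.+1%:R * `|p| * (1 + `|v|) by rewrite !mulr_ge0 ?addr_ge0.
have Q0 : 0 < Q by rewrite /Q; lra.
pose D := Num.min (Num.min s d1) (Num.min d2 (k / 3)).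
have D0 : 0 < D by rewrite !lt_min s0 d10 d20 divr_gt0.
pose b := D / (2 * Q).
have b0 : 0 < b by rewrite divr_gt0 // mulr_gt0.
have bQ : b * Q < D.
  have -> : b * Q = D / 2 by rewrite /b; field; rewrite gt_eqF.
  lra.
have := bQ; rewrite !lt_min => /andP[/andP[bs bd1] /andP[bd2 bk]].
have bQ' : b * (1 + `|v|) + b * `|g + e| + b * (n.+1%:R * `|p| * (1 + `|v|)) = b * Q.
  by rewrite /Q; ring.
have bv : b * (1 + `|v|) = b + b * `|v| by ring.
have bv0 : 0 <= b * `|v| by rewrite mulr_ge0 // ltW.
have bg0 : 0 <= b * `|g + e| by rewrite mulr_ge0 // ltW.
have bp0 : 0 <= b * (n.+1%:R * `|p| * (1 + `|v|)) by rewrite mulr_ge0 // ltW.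
have b_d1 : 0 < b < d1 by rewrite b0; lra.
have b_s : 0 < b < s by rewrite b0; lra.
have xib : `|xi b - z0.2| <= b * (1 + `|v|).
  rewrite -[xi b - _](subrK (b *: v)); apply: le_trans (ler_normD _ _) _.
  by rewrite normrZ (gtr0_norm b0) bv; have := xi1 b b_d1; lra.
have hb : `|(b, xi b - z0.2)| < d2.
  by rewrite prod_normE /= (gtr0_norm b0) gt_max; apply/andP; split; lra.
have := f2 _ hb; have -> : z0 + (b, xi b - z0.2) = (z0.1 + b, xi b).
  by rewrite -[LHS]/(z0.1 + b, z0.2 + (xi b - z0.2)) subrKC.
rewrite ltr_norml => /andP[fb _].
have := dP s b b_s sd.
have pb : - dot p (xi b - z0.2) >= - (b * (n.+1%:R * `|p| * (1 + `|v|))).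
  rewrite lerN2; apply: le_trans (ler_norm _) (le_trans (normr_dot_le _ _) _).
  by rewrite [leRHS]mulrCA ler_wpM2l // mulr_ge0.
have gb : b * (g + e) >= - (b * `|g + e|).
  by rewrite -mulrN ler_wpM2l ?(ltW b0) // lerNl -normrN ler_norm.
move: pb; rewrite !dotBr; lra.
Qed.

(** * The coupled system *)

Lemma hamiltonian_differentiable (R : realType) N m
    (H : 'I_m.+1 -> 'rV[R]_N.+1 -> 'rV[R]_N.+1 -> R) j z :
  hamiltonians H -> differentiable (fun z : 'rV[R]_N.+1 * 'rV[R]_N.+1 => H j z.1 z.2) z.
Proof. by case=> _ _ _ HC1; have [] := HC1 j z I. Qed.

Lemma hamiltonian_continuous (R : realType) N m
    (H : 'I_m.+1 -> 'rV[R]_N.+1 -> 'rV[R]_N.+1 -> R) j y :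
  hamiltonians H -> continuous (H j y).
Proof.
move=> HH p; apply/continuous_dist => e e0.
have := differentiable_continuous (hamiltonian_differentiable j (y, p) HH).
move=> /continuous_dist /(_ e e0)[d d0 dP]; exists d => // h hd.
have := dP (0, h); rewrite prod_normE /= normr0 (max_idPr _) // addr0.
exact.
Qed.

(** The radius is uniform in [y], because the lower growth function does not depend on position. *)
Lemma hamiltonian_superlinear (R : realType) N m
    (H : 'I_m.+1 -> 'rV[R]_N.+1 -> 'rV[R]_N.+1 -> R) j (M : R) :
  hamiltonians H -> exists2 r, 0 < r & forall y p, r <= enorm p -> M * enorm p <= H j y p.
Proof.
case=> _ [a [b [sa _ ab]]] _ _.
have /cvgryPge /(_ M) [r [_ rP]] := sa.
exists (Num.max 1 (r + 1)) => [|y p]; first by rewrite lt_max ltr01.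
rewrite ge_max => /andP[p1 pr].
have p0 : 0 < enorm p by lra.
have := rP (enorm p); rewrite ler_pdivlMr // => /(_ _)/wrap[]; first by lra.
by move=> /le_trans; apply; case/andP: (ab j y p).
Qed.

Lemma hamiltonian_coercive (R : realType) N m
    (H : 'I_m.+1 -> 'rV[R]_N.+1 -> 'rV[R]_N.+1 -> R) j y :
  hamiltonians H -> coercive (H j y).
Proof.
move=> HH M; have [r r0 rP] := hamiltonian_superlinear j M HH.
by exists r => // p; exact: rP.
Qed.

Lemma lipschitz_bound (R : realType) (V W : normedModType R) (f : V -> W) (A : set V) :
  [lipschitz f z | z in A] ->
  exists2 L : R, 0 < L & forall z z', A z -> A z' -> `|f z - f z'| <= L * `|z - z'|.
Proof.
move=> /pinfty_ex_gt0[L L0 LP]; exists L => // z z' Az Az'.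
exact: (LP (z, z')).
Qed.

Section CoupledEquation.
Variables (R : realType) (N m : nat).
Variables (H : 'I_m.+1 -> 'rV[R]_N.+1 -> 'rV[R]_N.+1 -> R) (B : 'M[R]_m.+1).
Variables (u : R -> 'rV[R]_N.+1 -> 'cV[R]_m.+1).
Hypothesis HH : hamiltonians H.
Hypothesis u_lip : forall S : R, 0 < S ->
  [lipschitz u z.1 z.2 | z in [set z : R * 'rV[R]_N.+1 | 0 <= z.1 <= S]].
Implicit Types (j : 'I_m.+1) (z : R * 'rV[R]_N.+1).

(** [u] in the coupling term is treated as known, so each component solves a scalar equation. *)
Definition coupled_hamiltonian j z (p : 'rV[R]_N.+1) : R :=
  H j z.2 p + (B *m u z.1 z.2) j 0.

Lemma coupled_subsolution j : viscosity_subsolution H B u ->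
  scalar_subsolution (coupled_hamiltonian j) (fun z => u z.1 z.2 j 0).
Proof.
move=> usub phi [t x] /= t0 phiC phimax; rewrite addrA.
exact: (usub j phi t x t0 phiC phimax).
Qed.

Lemma coupled_supersolution j : viscosity_supersolution H B u ->
  scalar_supersolution (coupled_hamiltonian j) (fun z => u z.1 z.2 j 0).
Proof.
move=> usup phi [t x] /= t0 phiC phimin; rewrite addrA.
exact: (usup j phi t x t0 phiC phimin).
Qed.

Lemma cV_coord_le (X : 'cV[R]_m.+1) j : `|X j 0| <= `|X|.
Proof.
rewrite [leRHS]/Num.norm/= mx_normrE.
exact: (le_bigmax _ (fun ij : 'I_m.+1 * 'I_1 => `|X ij.1 ij.2|) (j, 0)).
Qed.

Lemma solution_continuous z : 0 < z.1 -> {for z, continuous (fun z => u z.1 z.2)}.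
Proof.
move=> z0; apply/continuous_dist => e e0.
have z20 : 0 < 2 * z.1 by rewrite mulr_gt0.
have [L L0 LP] := lipschitz_bound (u_lip z20).
exists (Num.min z.1 (e / L)) => [|h]; first by rewrite lt_min z0 divr_gt0.
rewrite lt_min ltr_pdivlMr // => /andP[hz he].
have h1 : `|h.1| <= `|h| by rewrite prod_normE le_max lexx.
have hl := ler_norm h.1; have := ler_norm (- h.1); rewrite normrN => hu.
apply: le_lt_trans (LP (z + h) z _ _) _; rewrite /=.
- by apply/andP; split; lra.
- by apply/andP; split; lra.
by rewrite addrC addKr mulrC.
Qed.

Lemma solution_coord_continuous j z :
  0 < z.1 -> {for z, continuous (fun z => u z.1 z.2 j 0)}.
Proof.
move=> /solution_continuous /continuous_dist uz; apply/continuous_dist => e e0.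
have [d d0 dP] := uz e e0; exists d => // h /dP; apply: le_lt_trans.
by have := cV_coord_le (u (z + h).1 (z + h).2 - u z.1 z.2) j; rewrite !mxE.
Qed.

Lemma coupling_continuous j z :
  0 < z.1 -> {for z, continuous (fun z => (B *m u z.1 z.2) j 0)}.
Proof.
move=> /solution_continuous /continuous_dist uz; apply/continuous_dist => e e0.
pose C := \sum_k `|B j k| + 1.
have C0 : 0 < C by rewrite ltr_wpDl // sumr_ge0.
have [d d0 dP] := uz _ (divr_gt0 e0 C0); exists d => // h /dP.
rewrite ltr_pdivlMr //; apply: le_lt_trans.
set X := u _ _; set Y := u _ _.
have -> : (B *m X) j 0 - (B *m Y) j 0 = \sum_k B j k * (X - Y) k 0.
  by rewrite !mxE -sumrB; apply: eq_bigr => k _; rewrite !mxE mulrBr.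
apply: le_trans (ler_norm_sum _ _ _) _.
apply: (@le_trans _ _ (\sum_k `|B j k| * `|X - Y|)).
  by apply: ler_sum => k _; rewrite normrM ler_wpM2l // cV_coord_le.
by rewrite -mulr_suml mulrC ler_wpM2l // lerDl.
Qed.

Lemma solution_space_lipschitz j (S : R) : 0 < S -> exists2 L : R, 0 < L &
  forall s y y', 0 < s < S -> `|u s y j 0 - u s y' j 0| <= L * `|y - y'|.
Proof.
move=> S0; have [L L0 LP] := lipschitz_bound (u_lip S0); exists L => // s y y' /andP[s0 sS].
have sS' : 0 <= s <= S by rewrite !ltW.
have := LP (s, y) (s, y') sS' sS'; rewrite /= => H1.
have := cV_coord_le (u s y - u s y') j; rewrite !mxE => /le_trans; apply.
apply: le_trans H1 _; rewrite ler_wpM2l ?(ltW L0) //.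
rewrite -[X in `|X|]/(s - s, y - y') prod_normE /= subrr normr0.
by rewrite ge_max normr_ge0 lexx.
Qed.

Lemma hamiltonian_space_continuous j (M e : R) (y : 'rV[R]_N.+1) : 0 < e ->
  exists2 d : R, 0 < d & forall y' p, `|y' - y| < d -> enorm p <= M ->
    `|H j y' p - H j y p| < e.
Proof.
move=> e0; have M0 : 0 < `|M| + 1 by rewrite ltr_wpDl.
case: HH => /(_ j _ M0 e e0)[d d0 dP] _ _ _; exists d => // y' p yd pM.
have pM1 : enorm p < `|M| + 1 by have := ler_norm M; lra.
apply: (dP (y', p) (y, p) pM1 pM1).
rewrite -[X in `|X|]/(y' - y, p - p) prod_normE /= subrr normr0.
by rewrite gt_max yd.
Qed.

Lemma coupled_hamiltonian_usc j z (M e : R) : 0 < z.1 -> 0 < e ->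
  exists2 d : R, 0 < d & forall z' p, `|z' - z| < d -> `|p| <= M ->
    coupled_hamiltonian j z' p <= coupled_hamiltonian j z p + e.
Proof.
move=> z0 e0; have e20 : 0 < e / 2 by rewrite divr_gt0.
have [d1 d10 d1P] := hamiltonian_space_continuous j (N.+1%:R * M) z.2 e20.
have /continuous_dist /(_ _ e20)[d2 d20 d2P] := @coupling_continuous j z z0.
exists (Num.min d1 d2) => [|z' p]; first by rewrite lt_min d10.
rewrite lt_min => /andP[zd1 zd2] pM.
have := d2P (z' - z) zd2; rewrite subrKC ltr_norml => /andP[_ c2].
have y1 : `|z'.2 - z.2| < d1.
  by apply: le_lt_trans zd1; rewrite prod_normE le_max lexx orbT.
have pM' : enorm p <= N.+1%:R * M.
  by apply: le_trans (enorm_le_normr p) _; rewrite ler_wpM2l.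
have := d1P z'.2 p y1 pM'; rewrite ltr_norml => /andP[_ h2].
by rewrite /coupled_hamiltonian; lra.
Qed.

Lemma coupled_hamiltonian_continuous j z : continuous (coupled_hamiltonian j z).
Proof.
move=> p; apply/continuous_dist => e e0.
have /continuous_dist /(_ e e0)[d d0 dP] := @hamiltonian_continuous _ _ _ _ j z.2 HH p.
by exists d => // h /dP; rewrite /coupled_hamiltonian opprD addrACA subrr addr0.
Qed.

Lemma coupled_hamiltonian_coercive j z : coercive (coupled_hamiltonian j z).
Proof.
move=> M; have [r r0 rP] := hamiltonian_superlinear j (M + 1) HH.
set c := (B *m u z.1 z.2) j 0.
exists (Num.max r `|c|) => [|p]; first by rewrite lt_max r0.
rewrite ge_max => /andP[/(rP z.2)]; rewrite mulrDl mul1r /coupled_hamiltonian -/c.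
by have := ler_norm (- c); rewrite normrN; lra.
Qed.

Lemma coupled_hamiltonian_convex j z : strictly_convex (coupled_hamiltonian j z).
Proof.
case: HH => _ _ Hc _ p q l pq l01; have := Hc j z.2 p q l pq l01.
by rewrite /coupled_hamiltonian; lra.
Qed.

(** A Fenchel inequality with displaced base point, uniform in all momenta. Uniform continuity of
    [H] settles bounded momenta; for large ones the uniform superlinear growth dominates [dot p w],
    and the conjugate is bounded below by its competitor at momentum 0. *)
Lemma coupled_fenchel_young j z (M e : R) : 0 < z.1 -> 0 < e ->
  exists2 d : R, 0 < d & forall z' p w, `|z' - z| < d -> `|w| <= M ->
    dot p w - conjugate (coupled_hamiltonian j z) w - e <= coupled_hamiltonian j z' p.
Proof.
move=> z0 e0; have e20 : 0 < e / 2 by rewrite divr_gt0.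
have fy q p : dot p q - coupled_hamiltonian j z p <= conjugate (coupled_hamiltonian j z) q.
  by apply: fenchel_young; [exact: coupled_hamiltonian_continuous | exact: coupled_hamiltonian_coercive].
pose NM := N.+1%:R * M.
have [r r0 rP] := hamiltonian_superlinear j (NM + 1) HH.
pose r' := Num.max r `|H j z.2 0|.
have [d1 d10 d1P] := hamiltonian_space_continuous j r' z.2 e20.
have /continuous_dist /(_ _ e20)[d2 d20 d2P] := @coupling_continuous j z z0.
exists (Num.min d1 d2) => [|z' p w]; first by rewrite lt_min d10.
rewrite lt_min => /andP[zd1 zd2] wM.
have := d2P (z' - z) zd2; rewrite subrKC ltr_norml => /andP[c2 _].
have y1 : `|z'.2 - z.2| < d1.
  by apply: le_lt_trans zd1; rewrite prod_normE le_max lexx orbT.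
have [pr|/ltW] := leP (enorm p) r'.
  have := d1P z'.2 p y1 pr; rewrite ltr_norml => /andP[h2 _].
  by have := fy w p; move: c2; rewrite /coupled_hamiltonian; lra.
rewrite ge_max => /andP[/(rP z'.2) hp h0p].
have := fy w 0; rewrite dot0l sub0r /coupled_hamiltonian => f0.
have pw : dot p w <= NM * enorm p.
  apply: le_trans (ler_norm _) (le_trans (normr_dot_le _ _) _).
  rewrite /NM -!mulrA ler_wpM2l // mulrC.
  apply: ler_pM => //; exact: normr_le_enorm.
have := ler_norm (H j z.2 0).
by move: c2 hp; rewrite mulrDl mul1r; lra.
Qed.

(** The joint differential of [H], restricted to directions [(0, h)], is some linear form;
    maximality identifies it with [v]. *)
Lemma coupled_hamiltonian_expansion j z v p :
  dot_maximizer (coupled_hamiltonian j z) v p ->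
  forall e : R, 0 < e -> exists2 d : R, 0 < d & forall h, `|h| < d ->
    `|coupled_hamiltonian j z (p + h) - coupled_hamiltonian j z p - dot v h| <= e * `|h|.
Proof.
move=> pmax; have dH := hamiltonian_differentiable j (z.2, p) HH.
pose l h := 'd (fun z : 'rV[R]_N.+1 * 'rV[R]_N.+1 => H j z.1 z.2) (z.2, p) (0, h).
apply: (@maximizer_expansion _ _ _ v p l) => // [t h|e e0].
  rewrite /l -[t * _]/(t *: _) -linearZ; congr ('d _ _ _).
  by congr pair; rewrite scaler0.
have [d d0 dP] := diff_expansion dH e0; exists d => // h hd.
have := dP (0, h); rewrite prod_normE /= normr0 (max_idPr _) // addr0 => /(_ hd).
by rewrite /coupled_hamiltonian opprD addrACA subrr addr0.
Qed.

Lemma coupled_maximizer j z v p :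
  dot_maximizer (H j z.2) v p -> dot_maximizer (coupled_hamiltonian j z) v p.
Proof. by move=> pmax q; have := pmax q; rewrite /coupled_hamiltonian; lra. Qed.

End CoupledEquation.

(** * Differentiability along calibrated curves *)

(** [xi s] stands for the curve at time [t - s], hence the velocity [- v]. The lower and upper
    estimates combine into a differential with time slope [- G z0 p] and space slope [p]. *)
Lemma differentiable_along_calibrated (R : realType) (N m : nat)
    (H : 'I_m.+1 -> 'rV[R]_N.+1 -> 'rV[R]_N.+1 -> R) (B : 'M[R]_m.+1)
    (u : R -> 'rV[R]_N.+1 -> 'cV[R]_m.+1) (j : 'I_m.+1) (s0 : R)
    (y0 v p : 'rV[R]_N.+1) (xi : R -> 'rV[R]_N.+1) :
  hamiltonians H ->
  (forall S : R, 0 < S ->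
    [lipschitz u z.1 z.2 | z in [set z : R * 'rV[R]_N.+1 | 0 <= z.1 <= S]]) ->
  viscosity_subsolution H B u -> viscosity_supersolution H B u ->
  0 < s0 -> dot_maximizer (H j y0) (- v) p ->
  (forall e : R, 0 < e -> exists2 d : R, 0 < d & forall s, 0 < s < d ->
     `|xi s - y0 - s *: - v| <= e * s) ->
  (forall e : R, 0 < e -> exists2 d : R, 0 < d & forall a b, 0 < b < a -> a < d ->
     dot p (xi a - xi b) - (a - b) * (coupled_hamiltonian H B u j (s0, y0) p + e)
     <= u (s0 + a) (xi a) j 0 - u (s0 + b) (xi b) j 0) ->
  differentiable_along H B u j s0 y0 v.
Proof.
move=> HH u_lip usub usup s00 pmax xid inc.
pose f z := u z.1 z.2 j 0; pose z0 : R * 'rV[R]_N.+1 := (s0, y0).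
pose G := coupled_hamiltonian H B u j.
have pmaxG : dot_maximizer (G z0) (- v) p by exact: coupled_maximizer.
have fc z : 0 < z.1 -> {for z, continuous f}.
  by move=> zpos; exact: solution_coord_continuous.
have S0 : 0 < 2 * z0.1 by rewrite mulr_gt0.
have [L L0 fL] := solution_space_lipschitz u_lip j S0.
have seg : segment_bound f z0 (- v) p (G z0 p).
  apply: (subsolution_segment_bound (coupled_subsolution usub) _ fc fL) => //.
  - by move=> M e e0; exact: coupled_fenchel_young.
  - exact: coupled_hamiltonian_continuous.
  - exact: coupled_hamiltonian_coercive.
  - exact: coupled_hamiltonian_convex.
have touch := touch_of_increments (fc z0 s00) xid inc.
have low := lower_touching seg xid touch.
have back : forall lam e : R, 0 < lam -> 0 < e -> exists2 d : R, 0 < d & forall r, 0 < r < d ->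
    f (z0 - (lam * r) *: (1, - v)) - f z0 - G z0 p * (lam * r) + dot p ((lam * r) *: - v)
      <= e * r.
  apply: (supersolution_backward (coupled_supersolution usup) _ (ltW L0) fc fL) => //.
  - by move=> M e e0; exact: coupled_hamiltonian_usc.
  - exact: coupled_hamiltonian_expansion.
have upp := upper_touching seg back.
have fE e : 0 < e -> exists2 d : R, 0 < d & forall h, `|h| < d ->
    `|f (z0 + h) - f z0 - (- G z0 p * h.1 + dot p h.2)| <= e * `|h|.
  move=> e0; have [d1 d10 lowP] := low e e0; have [d2 d20 uppP] := upp e e0.
  exists (Num.min d1 d2) => [|h]; first by rewrite lt_min d10.
  rewrite lt_min => /andP[/lowP hl /uppP hu].
  by rewrite ler_norml; apply/andP; split; lra.
have fx : grad (fun y => u s0 y j 0) y0 = p by exact: (expansion_space fE).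
split.
- by have [] := is_diff_affine fE.
(* By duality the gradient of the Lagrangian at [- v] is the same maximizer [p]. *)
- rewrite fx; apply/esym/grad_expansion => e e0.
  have [_ _ Hsc _] := HH.
  have [d d0 dP] := conjugate_expansion (hamiltonian_continuous HH)
    (hamiltonian_coercive _ _ HH) (Hsc j y0) pmax e0.
  exists d => // h /dP; rewrite -/(conjugate _ _) => /andP[h0 h1].
  by rewrite ger0_norm.
by rewrite fx (expansion_time fE) /G /coupled_hamiltonian /=; ring.
Qed.

(** Calibration writes the increment as an action. The Fenchel inequality at the fixed momentum [p]
    bounds its integrand below by a function affine in the velocity, and near [t] the Hamiltonian at
    [p] exceeds its value at [t] by at most [e]. *)
Lemma calibrated_increments (R : realType) (N m : nat)
    (H : 'I_m.+1 -> 'rV[R]_N.+1 -> 'rV[R]_N.+1 -> R) (B : 'M[R]_m.+1)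
    (u : R -> 'rV[R]_N.+1 -> 'cV[R]_m.+1) (T t : R) (j : 'I_m.+1)
    (eta : mode_path R m -> R -> 'rV[R]_N.+1) (w : mode_path R m)
    (v p : 'rV[R]_N.+1) :
  hamiltonians H ->
  (forall S : R, 0 < S ->
    [lipschitz u z.1 z.2 | z in [set z : R * 'rV[R]_N.+1 | 0 <= z.1 <= S]]) ->
  calibrated H B u T eta w -> regular_off_jumps T eta w ->
  0 < t < T -> left_limit w t j ->
  (forall e : R, 0 < e -> exists2 d : R, 0 < d & forall s, 0 < s < d ->
     `|eta w (t - s) - eta w t - s *: v| <= e * s) ->
  forall e : R, 0 < e -> exists2 d : R, 0 < d & forall a b, 0 < b < a -> a < d ->
     dot p (eta w (t - a) - eta w (t - b))
     - (a - b) * (coupled_hamiltonian H B u j (T - t, eta w t) p + e)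
     <= u (T - t + a) (eta w (t - a)) j 0 - u (T - t + b) (eta w (t - b)) j 0.
Proof.
move=> HH u_lip cal reg /andP[t0 tT] /nbhs_normP[d0 /= d00 wj] etad e e0.
have Tt0 : 0 < (T - t, eta w t).1 by rewrite subr_gt0.
have [d1 d10 usc] := coupled_hamiltonian_usc B HH u_lip j `|p| Tt0 e0.
have [d2 d20 eta1] := etad 1 ltr01.
have v0 := normr_ge0 v; have v1 : 0 < 1 + `|v| by lra.
(* [d0] keeps the mode equal to [j] and [t] keeps times positive; the other two keep the curve
   within [d1] of its position at [t]. *)
exists (Num.min (Num.min d0 t) (Num.min d2 (d1 / (1 + `|v|)))) => [|a b].
  by rewrite !lt_min d00 t0 d20 divr_gt0.
move=> /andP[b0 ba]; rewrite !lt_min ltr_pdivlMr // => /andP[/andP[ad0 at0] /andP[ad2 ad1]].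
have wjs s : t - a <= s <= t - b -> w s = j.
  move=> /andP[sa sb]; apply: wj; last by lra.
  by rewrite /= ltr_norml; apply/andP; split; lra.
have nojump s : t - a <= s <= t - b -> ~ jump_time w s.
  move=> sab; apply; rewrite (wjs s sab); move: sab => /andP[sa sb].
  apply/nbhs_normP; exists (Num.min (d0 - a) b) => [|x /=].
    by rewrite /= lt_min subr_gt0 ad0.
  rewrite lt_min ltr_norml ltr_norml => /andP[/andP[x1 x2] /andP[x3 x4]].
  apply: wj; last by lra.
  by rewrite /= ltr_norml; apply/andP; split; lra.
have sT s : t - a <= s <= t - b -> 0 < s < T.
  by move=> /andP[? ?]; apply/andP; split; lra.
have fy y q : dot p q - H j y p <= lagrangian H j y q.
  by apply: fenchel_young; [exact: hamiltonian_continuous | exact: hamiltonian_coercive].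
have tab : t - a < t - b by lra.
have ta0 : 0 <= t - a by lra.
have tbT : t - b <= T by lra.
have := cal (t - a) (t - b) j ta0 tab tbT.
have wjs' s : t - a <= s < t - b -> w s = j.
  by move=> /andP[? ?]; apply: wjs; apply/andP; split; lra.
move=> /(_ wjs') calE.
have -> : T - t + a = T - (t - a) by ring.
have -> : T - t + b = T - (t - b) by ring.
have -> : a - b = t - b - (t - a) by ring.
apply: action_lower_bound tab _ _ calE => s sab.
  by have [/(_ (nojump s sab))] := reg s (sT s sab).
rewrite /lagrangianG.
have := fy (eta w s) (- derive1 (eta w) s).
suff : coupled_hamiltonian H B u j (T - s, eta w s) p
    <= coupled_hamiltonian H B u j (T - t, eta w t) p + e.
  by rewrite {1}/coupled_hamiltonian /=; lra.
apply: usc => //; move: (sab) => /andP[sa sb].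
have ts : 0 < t - s < d2 by apply/andP; split; lra.
have := eta1 (t - s) ts; have -> : t - (t - s) = s by ring.
rewrite mul1r => etas.
rewrite -[X in `|X|]/(T - s - (T - t), eta w s - eta w t) prod_normE /= gt_max.
have -> : T - s - (T - t) = t - s by ring.
have ts0 : 0 < t - s by lra.
have tsv : (t - s) * (1 + `|v|) <= a * (1 + `|v|) by rewrite ler_wpM2r //; lra.
rewrite gtr0_norm //; apply/andP; split.
  have : 0 <= (t - s) * `|v| by rewrite mulr_ge0 // ltW.
  by move: tsv; rewrite mulrDr mulr1; lra.
rewrite -[eta w s - _](subrK ((t - s) *: v)); apply: le_lt_trans (ler_normD _ _) _.
by rewrite normrZ gtr0_norm //; move: tsv; rewrite mulrDr mulr1; lra.
Qed.

Theorem corollary7p4 (R : realType) (N m : nat)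
    (H : 'I_m.+1 -> 'rV[R]_N.+1 -> 'rV[R]_N.+1 -> R) (B : 'M[R]_m.+1)
    (P : probability (mode_path R m) R)
    (u0 : 'rV[R]_N.+1 -> 'cV[R]_m.+1)
    (u : R -> 'rV[R]_N.+1 -> 'cV[R]_m.+1)
    (T : R) (x : 'rV[R]_N.+1) (i : 'I_m.+1)
    (eta : mode_path R m -> R -> 'rV[R]_N.+1) (Omega' : set (mode_path R m))
    (HH : hamiltonians H)
    (HB : coupling_matrix B)
    (HP : markov_chain B P)
    (HP0 : forall j, (0 < P (start_at j))%E)
    (u0_bounded : bounded_set (range u0))
    (u0_lip : [lipschitz u0 y | y in [set: 'rV[R]_N.+1]])
    (u_sol : cauchy_solution H B u0 u)
    (u_lip : forall S : R, 0 < S ->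
       [lipschitz u z.1 z.2 | z in [set z : R * 'rV[R]_N.+1 | 0 <= z.1 <= S]])
    (T_gt0 : 0 < T)
    (eta_min : minimizes H u0 P u i T x eta)
    (Omega'_sub : Omega' `<=` start_at i)
    (Omega'_full : (cond_start P i).-negligible (~` Omega'))
    (Omega'_cal : forall w, Omega' w -> calibrated H B u T eta w)
    (Omega'_reg : forall w, Omega' w -> regular_off_jumps T eta w) :
  forall w, Omega' w -> forall t, 0 < t < T ->
    (~ jump_time w t ->
       differentiable_along H B u (w t) (T - t) (eta w t) (derive1 (eta w) t)) /\
    (jump_time w t -> forall j, left_limit w t j ->
       differentiable_along H B u j (T - t) (eta w t)
         (left_derivative (eta w) t)).
Proof.
move=> w Ow t t0T; have [usub usup _ _] := u_sol.
have Tt : 0 < T - t by move: t0T => /andP[_]; rewrite subr_gt0.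
(* Both cases of the theorem reduce to this: a left limit of the mode and a left expansion of the
   curve. *)
have main v j : left_limit w t j ->
    (forall e : R, 0 < e -> exists2 d : R, 0 < d & forall s, 0 < s < d ->
      `|eta w (t - s) - eta w t - s *: - v| <= e * s) ->
    differentiable_along H B u j (T - t) (eta w t) v.
  move=> wj etad.
  have [p pmax] := dot_maximizer_exists (- v)
    (@hamiltonian_continuous _ _ _ _ j (eta w t) HH) (hamiltonian_coercive _ _ HH).
  apply: (differentiable_along_calibrated HH u_lip usub usup Tt pmax etad).
  exact: (calibrated_increments p HH u_lip (Omega'_cal w Ow) (Omega'_reg w Ow) t0T wj etad).
have [regN regJ] := Omega'_reg w Ow t t0T; split=> [nj|jt j wj].
  apply: main => [|e e0].
    (* Off the jumps the mode is constant around [t], so [w t] is also its left limit. *)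
    by apply: cvg_within; apply: contrapT.
  have [/derivable_expansion /(_ e e0)[d d0 dP] _] := regN nj.
  exists d => // s /andP[s0 sd]; have := dP (- s).
  rewrite normrN gtr0_norm // => /(_ sd).
  by rewrite scalerN scaleNr.
apply: main wj _ => e e0; have [/cvgrPdist_le /(_ e e0) lq _] := regJ jt.
have /nbhs_normP[d /= d0 dP] := lq; exists d => // s /andP[s0 sd].
have := dP (- s); rewrite /= sub0r opprK gtr0_norm // => /(_ sd).
rewrite oppr_lt0 => /(_ s0).
set l := lim _; rewrite -/(left_derivative (eta w) t) => H1.
(* The remainder is [s] times the gap between the left derivative and the quotient at increment
   [- s]. *)
have -> : eta w (t - s) - eta w t - s *: - left_derivative (eta w) t
   = s *: (left_derivative (eta w) t - (- s)^-1 *: (eta w (- s + t) - eta w t)).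
  rewrite scalerBr scalerA invrN mulrN divff ?gt_eqF // scaleN1r scalerN opprK opprK.
  by rewrite addrC [t - s]addrC.
by rewrite normrZ gtr0_norm // mulrC ler_wpM2r // ltW.
Qed.
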